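(* Let $K$ be a finite simplicial complex that is weakly taut over a field $\mathbb{F}$. Then: (a) every full subcomplex of $K$ is homotopy equivalent either to a point or to a sphere; (b) $K$ is weakly taut over an arbitrary field.
   Context: A finite simplicial complex $K$ with vertex set $V(K)=[m]=\{v_1,\dots,v_m\}$ ($m\ge 0$) contains $\varnothing$ and every singleton $\{v_i\}$ as a face; for $m=0$, $K=\{\varnothing\}$. For $J\subseteq V(K)$, the full subcomplex $K|_J$ consists of all faces of $K$ contained in $J$. The irrelevant complex $\{\varnothing\}=K|_{\varnothing}$ is regarded as the sphere $S^{-1}$. Homotopy equivalence refers to geometric realizations. The dimension of a face $\sigma$ is $|\sigma|-1$, and $\mathrm{mdim}(K)$ is the minimal dimension of the maximal simplices of $K$ (so $\mathrm{mdim}(\{\varnothing\})=-1$). For a field $\mathbb{F}$, $\mathbb{F}[K]=\mathbb{F}[v_1,\dots,v_m]/\mathcal{I}_K$ is the Stanley-Reisner ring and $\widetilde{D}(K;\mathbb{F})=\dim_{\mathbb{F}}\mathrm{Tor}_{\mathbb{F}[v_1,\dots,v_m]}(\mathbb{F}[K],\mathbb{F})$; equivalently (Hochster's formula) $\widetilde{D}(K;\mathbb{F})=\sum_{J\subseteq[m]}\sum_{i\ge -1}\dim_{\mathbb{F}}\widetilde{H}_i(K|_J;\mathbb{F})$, where $\widetilde{H}_{-1}(\{\varnothing\};\mathbb{F})=\mathbb{F}$ is the only nonzero reduced homology group of $\{\varnothing\}$. $K$ with $m$ vertices is weakly taut over $\mathbb{F}$ if $\widetilde{D}(K;\mathbb{F})=2^{m-\mathrm{mdim}(K)-1}$.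 *)

(* Defs.v *)
From HB Require Import structures.
From mathcomp Require Import all_boot all_order all_algebra.
From mathcomp Require Import all_classical all_reals all_analysis.

Set Implicit Arguments.
Unset Strict Implicit.
Unset Printing Implicit Defensive.

Import Order.TTheory GRing.Theory Num.Theory.
Import numFieldNormedType.Exports.

Local Open Scope ring_scope.

(** * Simplicial complexes on the vertex set 'I_m, as sets of faces *)

Definition simplicial_complex (m : nat) (K : {set {set 'I_m}}) : Prop :=
  [/\ finset.set0 \in K,
      forall v : 'I_m, [set v]%SET \in K
    & forall s t : {set 'I_m}, t \subset s -> s \in K -> t \in K].

(* Kept as a family of subsets of the same 'I_m: the vertices outside J are
   simply not faces, which affects neither homology nor realization. *)
Definition full_subcomplex (m : nat) (K : {set {set 'I_m}}) (J : {set 'I_m}) :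
  {set {set 'I_m}} := [set s in K | s \subset J]%SET.

Definition face_dim (m : nat) (s : {set 'I_m}) : int := #|s|%:Z - 1.

Definition facets (m : nat) (K : {set {set 'I_m}}) : {set {set 'I_m}} :=
  [set s | maxset [pred t | t \in K] s]%SET.

(* The default value m - 1 bounds every face dimension from above, and a
   simplicial complex has at least one facet, so it never matters. *)
Definition mdim (m : nat) (K : {set {set 'I_m}}) : int :=
  \big[Order.min/(m%:Z - 1)]_(s in facets K) face_dim s.

(** * Reduced simplicial homology over a field *)

(* Everything is indexed by the number k of vertices of a face, i.e. k = i + 1
   in dimension i >= -1. *)
Definition faces (m : nat) (K : {set {set 'I_m}}) (k : nat) :
  {set {set 'I_m}} := [set s in K | #|s| == k]%SET.

(* The coefficient of t in the boundary of s; it is (-1)^j when t is s with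
   its j-th vertex (counted from 0) removed, and 0 otherwise. *)
Definition incidence (F : fieldType) (m : nat) (s t : {set 'I_m}) : F :=
  \sum_(v in s | t == s :\ v) (-1) ^+ #|[set w in s | (w < v)%N]%SET|.

(* Acts on row vectors of coefficients. For k = 0, k.-1 is a dummy: the empty
   face has no vertex to remove, so the matrix is zero, as it should be; for
   k = 1 this is the augmentation. *)
Definition boundary (F : fieldType) (m : nat) (K : {set {set 'I_m}}) (k : nat) :
  'M[F]_(#|faces K k|, #|faces K k.-1|) :=
  \matrix_(i, j) incidence F (enum_val i) (enum_val j).

(* The dimension of the reduced homology in dimension k - 1: cycles modulo
   boundaries, the quotient being represented by a complement. *)
Definition reduced_betti (F : fieldType) (m : nat) (K : {set {set 'I_m}})
    (k : nat) : nat :=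
  \rank (kermx (boundary F K k) :\: boundary F K k.+1)%MS.

(* The total dimension of Tor of the Stanley-Reisner ring, expressed by
   Hochster's formula; there are no faces with more than m vertices. *)
Definition tor_dim (F : fieldType) (m : nat) (K : {set {set 'I_m}}) : nat :=
  (\sum_(J : {set 'I_m}) \sum_(k < m.+1)
     reduced_betti F (full_subcomplex K J) k)%N.

(* The exponent is an integer, hence the equation in rat. *)
Definition weakly_taut (F : fieldType) (m : nat) (K : {set {set 'I_m}}) : Prop :=
  (tor_dim F K)%:R = (2 : rat) ^ (m%:Z - mdim K - 1).

(** * Geometric realization and homotopy equivalence *)

Local Open Scope classical_set_scope.

Definition realization (R : realType) (m : nat) (K : {set {set 'I_m}}) :
  set 'rV[R]_m :=
  [set x | [/\ forall i, 0 <= x ord0 i,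
               \sum_i x ord0 i = 1
             & [set i | x ord0 i != 0]%SET \in K] ].

Arguments realization R {m} K.

(* The unit sphere of R^n, i.e. the sphere of dimension n - 1; for n = 0 it is
   empty. *)
Definition unit_sphere (R : realType) (n : nat) : set 'rV[R]_n :=
  [set x | \sum_i x ord0 i ^+ 2 = 1].

Arguments unit_sphere R n : clear implicits.

(* Spaces are subsets of ambient topological spaces; maps are ambient
   functions of which only the restriction to the subset is relevant. *)
Definition cont_map (T U : topologicalType) (A : set T) (B : set U)
    (f : T -> U) : Prop :=
  {within A, continuous f} /\ f @` A `<=` B.

Definition homotopic (R : realType) (T U : topologicalType)
    (A : set T) (B : set U) (f g : T -> U) : Prop :=
  exists H : T * R -> U,
    [/\ cont_map (A `*` `[0, 1] : set (T * R)%type) B H,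
        forall x, A x -> H (x, 0) = f x
      & forall x, A x -> H (x, 1) = g x].

Definition homotopy_equivalent (R : realType) (T U : topologicalType)
    (A : set T) (B : set U) : Prop :=
  exists (f : T -> U) (g : U -> T),
    [/\ cont_map A B f, cont_map B A g,
        homotopic R A A (g \o f) id & homotopic R B B (f \o g) id].

(* Main.v *)
Require Import Defs.
From HB Require Import structures.
From mathcomp Require Import all_boot all_order all_algebra.
From mathcomp Require Import zify lra.

(** Let C be the complement of a facet s of minimal dimension.  Removing the
    vertices of s one at a time, Mayer-Vietoris shows that for each J \subset C
    the total Betti numbers of the K|(J + t), t \subset s, add up to at least
    that of the irrelevant complex, i.e. 1, which gives the lower bound 2^|C|.
    K is weakly taut iff all these sums are 1.

    If they are, then every missing face g of K (a minimal non-face) has exactly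
    one vertex in C.  Indeed, when v is in s but not in g, the complex K|(v + g)
    is acyclic because K|g is not, so the boundary of the simplex g bounds in
    it; this forces every v + (g - u) to be a face, so that g is still missing
    from the link of v, and one can go on until s \subset g.  Hence K has exactly
    |C| missing faces G w, each with a private vertex w.

    Conversely, for such a K, the subcomplex K|J is a cone unless J is a union
    of sets G w.  In this last case it is a sphere of dimension |J \ C| - 1: the
    private vertices and the other vertices of J each span a face, and
    collapsing the private vertices to one point gives the boundary of a simplex.
    This description does not involve the field. *)

Set Implicit Arguments.
Unset Strict Implicit.
Unset Printing Implicit Defensive.

Import Order.TTheory GRing.Theory Num.Theory.

Local Open Scope ring_scope.

(** * Chains *)

Section Chains.
Variables (F : fieldType) (m : nat).
Local Notation face := {set 'I_m}.
Local Notation chain := {ffun face -> F^o}.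
Implicit Types (K L : {set face}) (s t U J : face) (u v w : 'I_m) (x y : chain).

(** For [v] outside [s] this is the coefficient of [s] in the boundary of [v |: s], since [v] itself
    is not counted. *)
Definition orientation v s : F :=
  (-1) ^+ #|[set w in s | (w < v)%N]|.

Lemma orientation_sqr v s : orientation v s * orientation v s = 1.
Proof. by rewrite -expr2 sqrr_sign. Qed.

Lemma orientation_neq0 v s : orientation v s != 0.
Proof. by rewrite signr_eq0. Qed.

(** Adding the smaller of [u] and [v] to [s] reverses the sign of the larger one, whereas adding the
    larger does not affect the smaller; so exactly one of the two products changes sign. *)
Lemma orientationU1 u v s : u != v -> u \notin s -> v \notin s ->
  orientation v (u |: s) * orientation u s =
  - (orientation u (v |: s) * orientation v s).
Proof.
wlog ltuv : u v / (u < v)%N => [IH uv us vs|uv us vs].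
  case: (ltngtP u v) => [ltuv|ltvu|/val_inj e]; first exact: IH.
    by rewrite [X in - X]IH ?opprK // eq_sym.
  by rewrite e eqxx in uv.
have -> : orientation v (u |: s) = - orientation v s.
  rewrite /orientation (_ : finset _ = u |: [set w in s | (w < v)%N]).
    by rewrite cardsU1 inE (negbTE us) /= exprS mulN1r.
  by apply/setP=> w; rewrite !inE; case: eqP => [->|] //=.
have -> : orientation u (v |: s) = orientation u s.
  congr (_ ^+ #|pred_of_set _|); apply/setP=> w; rewrite !inE.
  by case: eqP => [->|] //=; rewrite [RHS]andbC ltnNge ltnW.
by rewrite mulNr mulrC.
Qed.

(** Interior product with the vertex [v], as in an exterior algebra. Splitting the boundary into
    these operators makes its square vanish by anticommutation and isolates the faces through
    [v]. *)
Definition contract_fun v x : chain :=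
  [ffun s : face => if v \in s then 0 else orientation v s * x (v |: s)].

Fact contract_fun_is_linear v : linear (contract_fun v).
Proof.
move=> a x y; apply/ffunP=> s; rewrite !ffunE.
by case: ifP => _; rewrite ?scaler0 ?addr0 // mulrDr scalerAr.
Qed.
HB.instance Definition _ v :=
  GRing.isLinear.Build F chain chain *:%R (contract_fun v)
    (contract_fun_is_linear v).

Definition contract v : 'End(chain) := linfun (contract_fun v).
Definition bd : 'End(chain) := \sum_v contract v.

Lemma contractE v x s :
  contract v x s = if v \in s then 0 else orientation v s * x (v |: s).
Proof. by rewrite lfunE ffunE. Qed.

Lemma bdE x s : bd x s = \sum_(v | v \notin s) orientation v s * x (v |: s).
Proof.
rewrite sum_lfunE sum_ffunE [RHS]big_mkcond; apply: eq_bigr => v _.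
by rewrite contractE if_neg.
Qed.

Lemma contract_sqr v x : contract v (contract v x) = 0.
Proof.
apply/ffunP=> s; rewrite !contractE ffunE; case: ifP => // _.
by rewrite setU11 mulr0.
Qed.

Lemma contract_anticomm u v x : contract u (contract v x) = - contract v (contract u x).
Proof.
have [<-|neq] := eqVneq u v; first by rewrite contract_sqr oppr0.
apply/ffunP=> s; rewrite [RHS]ffunE !contractE !inE (negbTE neq).
rewrite [v == u]eq_sym (negbTE neq) /=.
have [us|us] := boolP (u \in s); have [vs|vs] := boolP (v \in s);
  rewrite ?mulr0 ?oppr0 //.
rewrite setUCA !mulrA -mulNr; congr (_ * _).
by rewrite mulrC orientationU1 // mulrC.
Qed.

Lemma contract_bd v x : contract v (bd x) = - bd (contract v x).
Proof.
rewrite !sum_lfunE linear_sum -sumrN; apply: eq_bigr => u _.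
exact: contract_anticomm.
Qed.

(** The first row and the first column cancel, and induction handles the rest. The diagonal is
    assumed to vanish because antisymmetry does not imply it in characteristic 2. *)
Lemma sum_anticomm_eq0 (V : zmodType) n (f : 'I_n -> 'I_n -> V) :
  (forall i, f i i = 0) -> (forall i j, f i j = - f j i) ->
  \sum_i \sum_j f i j = 0.
Proof.
elim: n f => [|n IH] f f0 fC; first by rewrite big_ord0.
rewrite big_ord_recl big_ord_recl f0 add0r.
under [X in _ + X]eq_bigr do rewrite big_ord_recl fC.
rewrite big_split /= sumrN addrA subrr add0r.
by apply: IH => *; [exact: f0|exact: fC].
Qed.

Lemma bd_sqr x : bd (bd x) = 0.
Proof.
rewrite [bd (bd x)]sum_lfunE.
under eq_bigr do rewrite sum_lfunE linear_sum.
apply: (sum_anticomm_eq0 (f := fun u v => contract u (contract v x))).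
  by move=> v; exact: contract_sqr.
by move=> u v; exact: contract_anticomm.
Qed.

Definition simplex (s : face) : chain := [ffun t : face => (t == s)%:R].

(** [K] may be any family of sets: below it is also the set of faces of a given size, or of those
    through a vertex. *)
Definition chains K : {vspace chain} := <<[seq simplex s | s <- enum K]>>%VS.

Lemma memv_chains K x : reflect (forall s, s \notin K -> x s = 0) (x \in chains K).
Proof.
have sumE (c : face -> F) s :
    (\sum_(t in K) c t *: simplex t : chain) s = if s \in K then c s else 0.
  rewrite sum_ffunE; have [sK|sK] := boolP (s \in K).
    rewrite (bigD1 s) //= big1 ?addr0 ?ffunE ?eqxx /= ?ffunE ?eqxx ?[_ *: _]mulr1 //.
    by move=> t /andP[_ ts]; rewrite !ffunE eq_sym (negbTE ts) scaler0.
  apply: big1 => t tK; rewrite !ffunE; case: eqP => [e|_]; last by rewrite scaler0.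
  by rewrite e tK in sK.
apply: (iffP idP) => [|x0].
  rewrite /chains => /coord_span -> s sK.
  rewrite sum_ffunE big1 // => i _; rewrite ffunE.
  have: [seq simplex s0 | s0 <- enum K]`_i \in [seq simplex s0 | s0 <- enum K].
    by apply: mem_nth; rewrite size_map -cardE.
  case/mapP=> t; rewrite mem_enum => tK ->; rewrite ffunE.
  case: eqP => [e|_]; last by rewrite scaler0.
  by rewrite e tK in sK.
have -> : x = \sum_(t in K) x t *: simplex t.
  by apply/ffunP=> s; rewrite sumE; case: ifP => // /negbT/x0.
apply: rpred_sum => t tK; apply/rpredZ/memv_span/map_f.
by rewrite mem_enum.
Qed.

Lemma dim_chains K : \dim (chains K) = #|K|.
Proof.
have: free [seq simplex s | s <- enum K].
  suff: free (in_tuple [seq simplex s | s <- enum K]) by [].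
  apply/freeP => c c0 i; have ltiK: (i < size (enum K))%N by rewrite -(size_map simplex).
  have /ffunP/(_ (nth finset.set0 (enum K) i)) := c0.
  rewrite sum_ffunE [RHS]ffunE (bigD1 i) //= big1 ?addr0 => [|j ji].
    by rewrite ffunE (nth_map finset.set0) // ffunE eqxx [_ *: _]mulr1.
  have ltjK: (j < size (enum K))%N by rewrite -(size_map simplex).
  rewrite ffunE (nth_map finset.set0) // ffunE nth_uniq ?enum_uniq //.
  by rewrite eq_sym (inj_eq val_inj) (negbTE ji) scaler0.
by rewrite /free => /eqP ->; rewrite size_map -cardE.
Qed.

Lemma chains_subset K L : K \subset L -> (chains K <= chains L)%VS.
Proof.
move=> KL; apply/subvP=> x /memv_chains x0; apply/memv_chains=> s sL.
by apply: x0; apply: contra sL; apply: (subsetP KL).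
Qed.

End Chains.

(** * Links, deletions and Betti numbers *)

Section Families.
Variable m : nat.
Local Notation face := {set 'I_m}.
Implicit Types (K L : {set face}) (s t U J : face) (u v w : 'I_m).

Definition down_closed K := forall s t, t \subset s -> s \in K -> t \in K.

Definition deletion v K : {set face} := [set s : face in K | v \notin s].

Definition link v K : {set face} := [set s : face | (v \notin s) && (v |: s \in K)].

Definition is_apex v K := forall s, s \in K -> v |: s \in K.

Lemma down_closed_deletion v K : down_closed K -> down_closed (deletion v K).
Proof.
move=> dK s t ts; rewrite !inE => /andP[/(dK _ _ ts) -> /=].
by apply: contra; apply: (subsetP ts).
Qed.

Lemma down_closed_link v K : down_closed K -> down_closed (link v K).
Proof.
move=> dK s t ts; rewrite !inE => /andP[vs vsK]; apply/andP; split.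
  by apply: contra vs; apply: (subsetP ts).
by apply: dK vsK; rewrite setUS.
Qed.

Lemma down_closed_full K J : down_closed K -> down_closed (full_subcomplex K J).
Proof.
move=> dK s t ts; rewrite !inE => /andP[/(dK _ _ ts) -> sJ] /=.
exact: subset_trans sJ.
Qed.

Lemma deletion_full v K J : v \notin J ->
  deletion v (full_subcomplex K (v |: J)) = full_subcomplex K J.
Proof.
move=> vJ; apply/setP=> s; rewrite !inE -andbA; congr (_ && _).
apply/andP/idP => [[/subsetP sJ vs]|sJ].
  apply/subsetP=> w ws; have:= sJ w ws; rewrite !inE => /orP[/eqP e|//].
  by rewrite -e ws in vs.
by rewrite (subset_trans sJ (subsetUr _ _)); split=> //; apply: contra vJ; apply: (subsetP sJ).
Qed.

Lemma link_full v K J : v \notin J ->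
  link v (full_subcomplex K (v |: J)) = full_subcomplex (link v K) J.
Proof.
move=> vJ; apply/setP=> s; rewrite !inE -andbA.
case: (boolP (v \in s)) => //= vs; congr (_ && _).
by rewrite subUset finset.sub1set setU11 -{2}(setU1K vJ) subsetD1 vs andbT.
Qed.

Lemma card_deletion_link v K : (#|K| = #|deletion v K| + #|link v K|)%N.
Proof.
rewrite -(cardsID [set s : face | v \notin s] K); congr (_ + _)%N.
  by apply: eq_card => s; rewrite !inE.
have inj : {in link v K &, injective (setU [set v])}.
  move=> s t; rewrite !inE => /andP[vs _] /andP[vt _] e.
  by rewrite -(setU1K vs) e setU1K.
rewrite -(card_in_imset inj); apply: eq_card => s; rewrite !inE negbK.
apply/andP/imsetP => [[vs sK]|[t]]; last by rewrite inE => /andP[vt vtK] ->; rewrite setU11.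
by exists (s :\ v); rewrite ?inE ?eqxx ?setD1K.
Qed.

End Families.

(* [lia] fails on occurrences of these atoms that are only convertible. *)
Ltac dim_lia :=
  do ?[move: (\dim _) => ?]; do ?[move: #|_| => ?]; lia.

Section Betti.
Variables (F : fieldType) (m : nat).
Local Notation face := {set 'I_m}.
Local Notation bd := (bd F m).
Implicit Types (K L : {set face}) (s t U J : face) (u v w : 'I_m).

Definition boundaries K := (bd @: chains F K)%VS.

(* dim ker bd - dim im bd on the ungraded chains of K, where ker and im have
   complementary dimensions in #|K|. *)
Definition betti K : nat := (#|K| - 2 * \dim (boundaries K))%N.

Lemma boundariesS K L : K \subset L -> (boundaries K <= boundaries L)%VS.
Proof. by move=> KL; rewrite limgS ?chains_subset. Qed.

Lemma boundaries_cycles K : down_closed K ->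
  (boundaries K <= chains F K :&: lker bd)%VS.
Proof.
move=> dK; apply/subvP=> _ /memv_imgP[x /memv_chains x0 ->].
rewrite memv_cap memv_ker bd_sqr eqxx andbT; apply/memv_chains=> s sK.
rewrite bdE big1 // => v _; rewrite x0 ?mulr0 //.
by apply: contra sK; apply: dK; exact: subsetUr.
Qed.

Lemma dim_cycles K : (\dim (chains F K :&: lker bd) + \dim (boundaries K) = #|K|)%N.
Proof. by rewrite limg_ker_dim dim_chains. Qed.

Lemma bettiE K : down_closed K -> (betti K + 2 * \dim (boundaries K) = #|K|)%N.
Proof.
move=> /boundaries_cycles/dimvS; have := dim_cycles K; rewrite /betti; dim_lia.
Qed.

(** The Euler characteristic modulo 2: an odd number of faces forces nonzero homology over every
    field. *)
Lemma odd_betti K : down_closed K -> odd (betti K) = odd #|K|.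
Proof. by move=> /bettiE <-; rewrite oddD oddM addbF. Qed.

Lemma acyclic_cycles K : down_closed K -> betti K = 0%N ->
  (chains F K :&: lker bd <= boundaries K)%VS.
Proof.
move=> dK b0; rewrite -(geq_leqif (dimv_leqif_sup (boundaries_cycles dK))).
by have := bettiE dK; have := dim_cycles K; dim_lia.
Qed.

Lemma contract_chains v K : (contract F v @: chains F K = chains F (link v K))%VS.
Proof.
apply/eqP; rewrite eqEsubv; apply/andP; split; apply/subvP=> x.
  case/memv_imgP=> y /memv_chains y0 ->; apply/memv_chains=> s; rewrite inE contractE.
  by case: ifP => //= _ sK; rewrite y0 ?mulr0.
move=> /memv_chains x0; apply/memv_imgP.
(* The preimage is the signed cone over [x] with apex [v]. *)
exists [ffun t : face => if v \in t then orientation F v (t :\ v) * x (t :\ v) else 0].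
  apply/memv_chains=> s sK; rewrite ffunE; case: ifP => // vs.
  by rewrite x0 ?mulr0 // inE setD1K // (negbTE sK) andbF.
apply/ffunP=> s; rewrite contractE ffunE setU11; case: ifPn => vs.
  by rewrite x0 // inE vs.
by rewrite setU1K // mulrA orientation_sqr mul1r.
Qed.

(** Contraction anticommutes with the boundary, so it carries boundaries in [K] to boundaries in the
    link, and by [contract_chains] it reaches all of them. *)
Lemma contract_boundaries v K :
  (contract F v @: boundaries K = boundaries (link v K))%VS.
Proof.
rewrite /boundaries -contract_chains.
apply/eqP; rewrite eqEsubv; apply/andP; split; apply/subvP=> x.
  case/memv_imgP=> _ /memv_imgP[y yK ->] ->.
  by rewrite contract_bd -linearN memv_img // memvN memv_img.
case/memv_imgP=> _ /memv_imgP[y yK ->] ->.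
rewrite -[bd _]opprK -contract_bd -linearN memv_img // memvN.
exact: memv_img.
Qed.

Lemma dim_boundaries_link v K :
  (\dim (boundaries K) =
   \dim (boundaries K :&: lker (contract F v)) + \dim (boundaries (link v K)))%N.
Proof. by rewrite -contract_boundaries limg_ker_dim. Qed.

(** The middle space consists of the boundaries of [K] whose support avoids [v]. Each inclusion
    bounds its dimension on one side and gives one of the two Mayer-Vietoris inequalities. *)
Lemma boundaries_deletion v K : down_closed K ->
  (boundaries (deletion v K) <= boundaries K :&: lker (contract F v)
     <= chains F (deletion v K) :&: lker bd)%VS.
Proof.
move=> dK; apply/andP; split; apply/subvP=> x.
  have sub : deletion v K \subset K by apply/subsetP=> s; rewrite inE => /andP[].
  move=> xB; rewrite memv_cap (subvP (boundariesS sub)) //=.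
  case/memv_imgP: xB => y /memv_chains y0 ->.
  rewrite memv_ker contract_bd (_ : contract F v y = 0) ?linear0 ?oppr0 //.
  apply/ffunP=> s; rewrite contractE ffunE; case: ifP => // vs.
  by rewrite y0 ?mulr0 // !inE eqxx andbF.
rewrite !memv_cap => /andP[xB]; have := subvP (boundaries_cycles dK) _ xB.
rewrite memv_cap => /andP[/memv_chains xK ->]; rewrite andbT memv_ker => /eqP cx.
apply/memv_chains=> s; rewrite inE negb_and negbK => /orP[/xK //|vs].
have /ffunP/(_ (s :\ v)) := cx; rewrite contractE ffunE !inE eqxx /= setD1K //.
by move/eqP; rewrite mulf_eq0 (negbTE (orientation_neq0 _ _ _)) => /eqP.
Qed.

(* This lemma and the next one are the Mayer-Vietoris sequence of
   K = deletion v K \cup (v * link v K). *)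
Lemma betti_link v K : down_closed K ->
  (betti (link v K) <= betti (deletion v K) + betti K)%N.
Proof.
move=> dK; have /andP[_ /dimvS] := boundaries_deletion v dK.
have := dim_boundaries_link v K; have := dim_cycles (deletion v K).
have := bettiE dK; have := bettiE (down_closed_deletion (v:=v) dK).
have := bettiE (down_closed_link (v:=v) dK); have := card_deletion_link v K.
dim_lia.
Qed.

Lemma betti_deletion_link v K : down_closed K ->
  (betti K <= betti (deletion v K) + betti (link v K))%N.
Proof.
move=> dK; have /andP[/dimvS + _] := boundaries_deletion v dK.
have := dim_boundaries_link v K; have := dim_cycles (deletion v K).
have := bettiE dK; have := bettiE (down_closed_deletion (v:=v) dK).
have := bettiE (down_closed_link (v:=v) dK); have := card_deletion_link v K.
dim_lia.
Qed.

(** The boundary is injective on the chains of faces through the apex, which are half of all faces;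
    so the boundaries have at least half the dimension of the chains and leave no homology. *)
Lemma betti_cone v K : down_closed K -> is_apex v K -> betti K = 0%N.
Proof.
move=> dK apex; pose S := [set s : face in K | v \in s].
have delE : deletion v K = link v K.
  apply/setP=> s; rewrite !inE andbC; congr (_ && _).
  by apply/idP/idP => [/apex|/dK]; apply=> //; exact: subsetUr.
have cardS : #|S| = #|link v K|.
  rewrite -[LHS](addKn #|deletion v K|) -[RHS](addKn #|deletion v K|).
  rewrite -card_deletion_link; congr (_ - _)%N.
  rewrite -(cardsID [set s : face | v \notin s] K); congr (_ + _)%N.
    by apply: eq_card => s; rewrite !inE.
  by apply: eq_card => s; rewrite !inE negbK andbC.
(* In the boundary of such a chain, the coefficient of [s :\ v] comes from [s] alone. *)
have capS : (chains F S :&: lker bd = 0)%VS.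
  apply/eqP; rewrite -subv0; apply/subvP=> x; rewrite memv_cap memv_ker memv0.
  case/andP=> /memv_chains xS /eqP bx; apply/eqP/ffunP=> s; rewrite ffunE.
  have [vs|vs] := boolP (v \in s); last by rewrite xS // inE (negbTE vs) andbF.
  have /ffunP/(_ (s :\ v)) := bx; rewrite bdE ffunE (bigD1 v) ?setD11 //=.
  rewrite setD1K // big1 ?addr0 => [/eqP|u /andP[us uv]].
    by rewrite mulf_eq0 (negbTE (orientation_neq0 _ _ _)) => /eqP.
  by rewrite xS ?mulr0 // !inE eqxx [v == u]eq_sym (negbTE uv) !andbF.
have SK : S \subset K by apply/subsetP=> s; rewrite inE => /andP[].
have := dimvS (boundariesS SK); rewrite {1}/boundaries limg_dim_eq // dim_chains.
by have := bettiE dK; have := card_deletion_link v K; rewrite delE cardS; dim_lia.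
Qed.

Lemma betti_link_full v K J : down_closed K -> v \notin J ->
  (betti (full_subcomplex (link v K) J) <=
   betti (full_subcomplex K J) + betti (full_subcomplex K (v |: J)))%N.
Proof.
move=> dK vJ; rewrite -link_full // -(deletion_full K vJ).
exact/betti_link/down_closed_full.
Qed.

End Betti.
(** * Missing faces of weakly taut complexes *)

Section TotalBetti.
Variables (F : fieldType) (m : nat).
Local Notation face := {set 'I_m}.
Implicit Types (K L : {set face}) (g s t U J C : face) (u v w : 'I_m).

Definition total_betti K : nat := \sum_J betti F (full_subcomplex K J).

(** For [J] disjoint from [s], the share of [total_betti] due to the sets whose trace outside [s] is
    [J]. *)
Definition fiber_betti s K J : nat :=
  \sum_(t : face | t \subset s) betti F (full_subcomplex K (J :|: t)).

Lemma sum_subsets (f : face -> nat) s v : v \in s ->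
  (\sum_(t : face | t \subset s) f t =
   \sum_(t : face | t \subset s :\ v) (f t + f (v |: t)))%N.
Proof.
move=> vs; rewrite (bigID (fun t : face => v \notin t)) big_split /=.
congr (_ + _)%N; first by apply: eq_bigl => t; rewrite subsetD1.
rewrite (reindex_onto (setU [set v]) (fun t => t :\ v)) => [|t /andP[_]] /=.
  apply: eq_bigl => t; rewrite subsetD1 negbK setU11 subUset finset.sub1set vs andbT.
  rewrite setDUl setDv set0U; congr (_ && _).
  by apply/eqP/idP => [<-|vt]; rewrite ?setD11 // (setDidPl _) // disjoint_sym disjoints1.
by rewrite negbK => vt; rewrite setD1K.
Qed.

Lemma sum_subset_pairs (f : face -> nat) s :
  (\sum_J f J = \sum_(J : face | J \subset ~: s) \sum_(t : face | t \subset s) f (J :|: t))%N.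
Proof.
rewrite pair_big_dep (reindex_onto (fun J => (J :\: s, J :&: s))
  (fun p : face * face => p.1 :|: p.2)) => [|[J t] /andP[/= Js ts]] /=.
  apply: eq_big => J; last by rewrite setUC setID.
  by rewrite setUC setID eqxx subsetIr setDE subsetIr.
by congr pair; apply/setP=> w; rewrite !inE; move: (subsetP Js w) (subsetP ts w);
  rewrite inE => /implyP + /implyP; case: (w \in J); case: (w \in t);
  case: (w \in s).
Qed.

(* C is the complement of s in the vertex set; it stays fixed when s shrinks in
   passing to links. *)
Definition is_facet s C K := s \in K /\ forall w, w \in C -> w |: s \notin K.

Lemma betti_irrelevant : betti F [set finset.set0 : face] = 1%N.
Proof.
have dK : down_closed [set finset.set0 : face].
  by move=> s t; rewrite !inE => ts /eqP s0; rewrite s0 subset0 in ts.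
have := odd_betti F dK; have := bettiE F dK; rewrite cards1; lia.
Qed.

(** Each [t] avoiding [v] is paired with [v |: t], and [betti_link_full] applies to each pair. *)
Lemma fiber_betti_link s K J v : down_closed K -> v \in s -> v \notin J ->
  (fiber_betti (s :\ v) (link v K) J <= fiber_betti s K J)%N.
Proof.
move=> dK vs vJ; rewrite /fiber_betti (sum_subsets _ vs); apply: leq_sum => t.
rewrite subsetD1 => /andP[_ vt]; rewrite setUCA; apply: betti_link_full => //.
by rewrite inE negb_or vJ.
Qed.

Lemma is_facet_link s C K v : v \in s -> v \notin C -> is_facet s C K ->
  is_facet (s :\ v) C (link v K).
Proof.
move=> vs vC [sK facet]; split=> [|w wC]; first by rewrite inE setD11 setD1K.
rewrite inE setUCA setD1K // (negbTE (facet w wC)) andbF //.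
Qed.

Lemma fiber_betti_gt0 s C K J : down_closed K -> is_facet s C K ->
  [disjoint C & s] -> J \subset C -> (0 < fiber_betti s K J)%N.
Proof.
have [n] := ubnP #|s|; elim: n s K => // n IH s K ltsn dK facet dis JC.
have [s0|[v vs]] := set_0Vmem s.
  rewrite /fiber_betti (bigD1 finset.set0) ?sub0set //= finset.setU0.
  (* Once [s] is empty, no vertex of [C] is a face, so only the irrelevant complex is left over
     [J]. *)
  rewrite (_ : full_subcomplex K J = [set finset.set0]) ?betti_irrelevant //.
  case: facet => sK facet; apply/setP=> t; rewrite !inE.
  apply/andP/eqP=> [[tK tJ]|->]; last by rewrite sub0set -s0.
  apply/eqP; rewrite -subset0; apply/subsetP=> w wt.
  have := facet w (subsetP JC _ (subsetP tJ _ wt)); rewrite s0 finset.setU0.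
  by rewrite (dK t) ?finset.sub1set.
have vC : v \notin C by rewrite (disjointFl dis).
apply: leq_trans (fiber_betti_link dK vs _); last first.
  by apply: contra vC; apply: (subsetP JC).
apply: IH => //.
- by move: ltsn; rewrite (cardsD1 v s) vs.
- exact: down_closed_link.
- exact: is_facet_link.
- by apply: disjointWr dis; exact: subD1set.
Qed.

(** Minimality is stated for the removal of one vertex; when [K] is closed downwards,
    [missing_face_proper] extends it to all proper subsets. *)
Definition missing_face g K := g \notin K /\ forall u, u \in g -> g :\ u \in K.

Lemma missing_face_neq0 g K : finset.set0 \in K -> missing_face g K -> g != finset.set0.
Proof. by move=> K0 [gK _]; apply: contra gK => /eqP ->. Qed.

Lemma missing_face_proper g K t : down_closed K -> missing_face g K -> t \proper g -> t \in K.
Proof.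
move=> dK [_ gK] /properP[tg [u ug ut]]; apply: (dK (g :\ u)); last exact: gK.
by rewrite subsetD1 tg.
Qed.

(** [K|g] consists of all subsets of [g] except [g] itself; their number is odd because [g] is
    nonempty, so [odd_betti] applies. *)
Lemma betti_missing_face g K : down_closed K -> finset.set0 \in K -> missing_face g K ->
  (0 < betti F (full_subcomplex K g))%N.
Proof.
move=> dK K0 gK; have dKg := down_closed_full (J := g) dK.
suff: odd (betti F (full_subcomplex K g)) by apply: contraTT; rewrite -eqn0Ngt => /eqP ->.
rewrite odd_betti // (_ : full_subcomplex K g = powerset g :\ g); last first.
  apply/setP=> t; rewrite !inE; have [->|tg] := eqVneq t g.
    by case: gK => /negbTE ->.
  rewrite andbC; case: (boolP (t \subset g)) => //= sub.
  by rewrite (missing_face_proper dK gK) // properEneq tg.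
have := cardsD1 g (powerset g); rewrite !inE subxx card_powerset => e.
have: odd (2 ^ #|g|) = false.
  by rewrite oddX orbF cards_eq0; apply/negbTE/(missing_face_neq0 K0 gK).
by rewrite e /= => /negbFE.
Qed.

(* The boundary of the simplex on g is a cycle of K, and the only faces of K
   on v |: g whose boundary involves g :\ u are g and v |: g :\ u. *)
Lemma acyclic_missing_face g K v : down_closed K -> missing_face g K -> v \notin g ->
  betti F (full_subcomplex K (v |: g)) = 0%N ->
  forall u, u \in g -> v |: (g :\ u) \in K.
Proof.
move=> dK [gK gD1] vg b0 u ug; have dKg := down_closed_full (J := v |: g) dK.
pose z := bd F m (simplex F g).
have zE t : z t = \sum_(w | (w \notin t) && (w |: t == g)) orientation F w t.
  rewrite /z bdE [RHS]big_mkcondr /=; apply: eq_bigr => w _; rewrite ffunE.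
  by case: eqP; rewrite ?mulr1 ?mulr0.
have: z \in (chains F (full_subcomplex K (v |: g)) :&: lker (bd F m))%VS.
  rewrite memv_cap memv_ker bd_sqr eqxx andbT; apply/memv_chains=> t tK.
  rewrite zE big_pred0 // => w; apply: contraNF tK => /andP[wt /eqP e].
  rewrite inE; apply/andP; split; last by rewrite -e setUCA subsetU ?subsetUr ?orbT.
  by have := gD1 w; rewrite -e setU1K ?setU11 // => ->.
move/(subvP (acyclic_cycles dKg b0))/memv_imgP => [c /memv_chains c0 zc].
have : z (g :\ u) != 0.
  rewrite zE (big_pred1 u) ?orientation_neq0 // => w.
  apply/andP/eqP=> [[wgu /eqP e]|->]; last by rewrite setD11 setD1K.
  apply/eqP; apply: contraTT ug => wu; rewrite -e !inE eqxx /= orbF.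
  by rewrite eq_sym.
apply: contraNT => vguK; rewrite zc bdE big1 // => w wgu.
rewrite c0 ?mulr0 // inE negb_and; have [-> | wv] := eqVneq w v; first by rewrite vguK.
have [-> | wu] := eqVneq w u; first by rewrite setD1K ?gK.
apply/orP; right; apply: contra wgu; rewrite subUset finset.sub1set => /andP[+ _].
by rewrite !inE (negbTE wv) wu.
Qed.

(** For a facet [s] of minimal dimension with complement [C] this is weak tautness, see
    [weakly_tautE]; the reverse inequality is [fiber_betti_gt0]. *)
Definition tight_fibers s C K := forall J, J \subset C -> (fiber_betti s K J <= 1)%N.

Lemma tight_fibers_unique s C K J t1 t2 : tight_fibers s C K -> J \subset C ->
  t1 \subset s -> t2 \subset s ->
  (0 < betti F (full_subcomplex K (J :|: t1)))%N ->
  (0 < betti F (full_subcomplex K (J :|: t2)))%N -> t1 = t2.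
Proof.
move=> tight JC t1s t2s b1 b2; apply: contraTeq (tight J JC) => t12.
rewrite -ltnNge /fiber_betti (bigD1 t1) // (bigD1 t2) /=; last by rewrite t2s eq_sym.
by rewrite addnA ltn_addr // -(addn1 1) leq_add.
Qed.

Lemma tight_fibers_link s C K v : down_closed K -> v \in s -> v \notin C ->
  tight_fibers s C K -> tight_fibers (s :\ v) C (link v K).
Proof.
move=> dK vs vC tight J JC; apply: leq_trans (tight J JC).
by apply: fiber_betti_link => //; apply: contra vC; apply: (subsetP JC).
Qed.

(** Induction on the number of vertices of [s] outside [g]: [K] is replaced by the link of such a
    vertex, which is removed from [s], while [C] and [g] stay the same. *)
Lemma card_missing_face s C K g : down_closed K -> is_facet s C K ->
  [disjoint C & s] -> tight_fibers s C K -> g \subset C :|: s ->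
  missing_face g K -> #|g :&: C| = 1%N.
Proof.
have [n] := ubnP #|s :\: g|; elim: n s K => // n IH s K ltsn dK facet dis tight gCs gK.
have K0 : finset.set0 \in K by case: facet => sK _; apply: dK sK; rewrite sub0set.
(* Otherwise [g] would lie in the face [s]. *)
have [w /setIP[wg wC]] : exists w, w \in g :&: C.
  apply/set0Pn; case: (gK) => + _; apply: contra => /eqP gC0.
  case: facet => sK _; apply: dK sK; apply/subsetP=> u ug.
  have := subsetP gCs u ug; rewrite inE => /orP[uC|//].
  by have := in_set0 u; rewrite -gC0 inE ug uC.
have [/subsetP sg|/subsetPn[v vs vg]] := boolP (s \subset g).
  (* A second vertex of [g] in [C] would make [w |: s] a proper subset of [g], hence a face, against
     the maximality of [s]. *)
  apply/eqP/cards1P; exists w; apply/setP=> u; rewrite !inE.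
  apply/andP/eqP=> [[ug uC]|->//]; apply/eqP; apply: contraT => uw.
  case: facet => _ /(_ w wC); rewrite (missing_face_proper dK gK) //.
  apply/properP; split; last first.
    by exists u => //; rewrite !inE negb_or uw (disjointFr dis).
  by apply/subsetP=> x; rewrite !inE => /orP[/eqP ->|/sg].
have vC : v \notin C by rewrite (disjointFl dis).
have gE : g = (g :&: C) :|: (g :&: s) by rewrite -setIUr; apply/esym/setIidPl.
(* In the fiber over [g :&: C] the set [g] already carries homology, so tightness leaves none for
   [v |: g]. *)
have acyclic : betti F (full_subcomplex K (v |: g)) = 0%N.
  apply/eqP; rewrite -leqn0 leqNgt; apply/negP => pos.
  have := @tight_fibers_unique s C K (g :&: C) (g :&: s) (v |: (g :&: s)) tight.
  rewrite subsetIr subsetIr subUset finset.sub1set vs subsetIr -gE setUCA -gE.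
  move=> /(_ isT isT isT (betti_missing_face dK K0 gK) pos) /setP/(_ v).
  by rewrite !inE eqxx (negbTE vg).
have gL : missing_face g (link v K).
  split=> [|u ug]; rewrite inE ?vg ?inE ?(negbTE vg) ?andbF /=.
    by case: gK => gK _; apply: contra gK; apply: dK; exact: subsetUr.
  exact: acyclic_missing_face.
apply: (IH (s :\ v) (link v K)) => //.
- by rewrite setDDl setUC -setDDl; move: ltsn; rewrite (cardsD1 v (s :\: g)) inE vs vg.
- exact: down_closed_link.
- exact: is_facet_link.
- by apply: disjointWr dis; exact: subD1set.
- exact: tight_fibers_link.
apply/subsetP=> u ug; have := subsetP gCs u ug; rewrite !inE.
by have [e|//] := eqVneq u v; rewrite -e ug in vg.
Qed.

End TotalBetti.

(** * Presentation of a tight complex by its missing faces *)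

Section Structure.
Variable m : nat.
Local Notation face := {set 'I_m}.
Implicit Types (K : {set face}) (g s t U J C W : face) (u v w : 'I_m).

Lemma missing_face_exists K t : t \notin K -> exists2 g : face, g \subset t & missing_face g K.
Proof.
move=> tK; have [g gmin gt] := @minset_exists _ (fun x : face => x \notin K) t tK.
exists g => //; case/minsetP: gmin => gK min; split=> // u ug.
apply: contraT => /min /(_ (subD1set _ _)) /setP/(_ u).
by rewrite setD11 ug.
Qed.

(* The sets G w are then exactly the missing faces of K. *)
Definition presents C (G : 'I_m -> face) K :=
  (forall w, w \in C -> G w :&: C = [set w]) /\
  forall t, (t \in K) = [forall w in C, ~~ (G w \subset t)].

Lemma tight_fibers_presents (F : fieldType) K s : down_closed K ->
  is_facet s (~: s) K -> tight_fibers F s (~: s) K ->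
  exists G, presents (~: s) G K.
Proof.
move=> dK facet tight; set C := ~: s in facet tight *.
have dis : [disjoint C & s] by rewrite disjoint_sym -subsets_disjoint.
have K0 : finset.set0 \in K by case: facet => sK _; apply: dK sK; rewrite sub0set.
have all g : g \subset C :|: s by rewrite setUC setUCr subsetT.
have one g : missing_face g K -> exists2 w, w \in C & g :&: C = [set w].
  move=> gK; have /eqP/cards1P[w e] := card_missing_face dK facet dis tight (all g) gK.
  by exists w => //; have := finset.set11 w; rewrite -e inE => /andP[].
(* Missing faces with the same trace on [C] belong to one fiber, where only one set carries
   homology. *)
have uniq g h : missing_face g K -> missing_face h K -> g :&: C = h :&: C -> g = h.
  have split_ x : x = (x :&: C) :|: (x :&: s) by rewrite -setIUr; apply/esym/setIidPl/all.
  move=> gK hK e; rewrite (split_ g) (split_ h) e; congr (_ :|: _).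
  apply: (tight_fibers_unique tight (subsetIr h C)); rewrite ?subsetIr //.
    by rewrite -e -split_; exact: betti_missing_face.
  by rewrite -split_; exact: betti_missing_face.
(* As [s] is a facet, [w |: s] contains a missing face; the single vertex of this face in [C] can
   only be [w]. *)
have ex w : w \in C -> exists g : face, missing_face g K /\ g :&: C = [set w].
  move=> wC; case: facet => sK /(_ w wC) /missing_face_exists[g gs gK].
  exists g; split=> //; case: (one g gK) => u uC e.
  have := finset.set11 u; rewrite -e => /setIP[/(subsetP gs)].
  by rewrite !inE => /orP[/eqP <- //|us]; rewrite (disjointFr dis) in us.
have [G GP] : exists G : 'I_m -> face, forall w, w \in C ->
    missing_face (G w) K /\ G w :&: C = [set w].
  pose P w g := w \in C -> missing_face g K /\ g :&: C = [set w].
  apply: (@fin_all_exists _ _ P) => w; rewrite /P.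
  by have [/ex[g ?]|_] := boolP (w \in C); [exists g|exists finset.set0].
exists G; split=> [w /GP[]//|t]; apply/idP/forall_inP=> [tK w /GP[[GK _] _]|nG].
  by apply: contra GK => Gt; exact: dK tK.
apply: contraT => /missing_face_exists[g gt gK]; have [w wC e] := one g gK.
have [GK GC] := GP w wC; have := nG w wC.
by rewrite (uniq (G w) g) ?gt // GC e.
Qed.

End Structure.

(** * Hochster's formula *)

(** A row basis of [M] spans the same image, and multiplication by it is injective. *)
Lemma dim_limg_mulmxr (F : fieldType) n p (M : 'M[F]_(n, p)) :
  \dim (limg (linfun (mulmxr M) : 'Hom('rV[F]_n, 'rV[F]_p))) = \rank M.
Proof.
pose f := linfun (mulmxr (row_base M)) : 'Hom('rV[F]_(\rank M), 'rV[F]_p).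
have -> : limg (linfun (mulmxr M)) = limg f.
  apply/vspaceP=> x; apply/memv_imgP/memv_imgP => [[u _ ->]|[u _ ->]].
    have /submxP[v e] : (u *m M <= row_base M)%MS by rewrite eq_row_base submxMl.
    by exists v; rewrite ?memvf // !lfunE.
  have /submxP[v e] : (u *m row_base M <= M)%MS.
    by rewrite -(eq_row_base M) submxMl.
  by exists v; rewrite ?memvf // !lfunE.
rewrite limg_dim_eq ?dimvf /dim /= ?mul1n //.
apply/eqP; rewrite -subv0; apply/subvP=> u; rewrite memv_cap memvf memv_ker memv0 lfunE /=.
by move/eqP=> u0; rewrite -(inj_eq (row_free_inj (row_base_free M))) /= u0 mul0mx.
Qed.

Section Hochster.
Variables (F : fieldType) (m : nat).
Local Notation face := {set 'I_m}.
Local Notation bd := (bd F m).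
Implicit Types (K A B : {set face}) (s t : face) (v : 'I_m).

Lemma incidence_bd s t : incidence F s t = bd (simplex F s) t.
Proof.
rewrite bdE; under [RHS]eq_bigr do rewrite ffunE mulr_natr mulrb.
rewrite -big_mkcondr /=; apply: eq_big => [v|v /andP[vs /eqP ->]].
  apply/andP/andP=> [[vs /eqP ->]|[vt /eqP <-]]; first by rewrite setD11 setD1K.
  by rewrite setU11 setU1K.
congr (_ ^+ #|pred_of_set _|); apply/setP=> w; rewrite !inE.
by have [->|] := eqVneq w v; rewrite ?ltnn ?andbF.
Qed.

(** Identifies the row vectors on which the boundary matrices act with the chains supported on
    [A]. *)
Definition realize_chain A (x : 'rV[F]_#|A|) : {ffun face -> F^o} :=
  \sum_i x 0 i *: simplex F (enum_val i).

Fact realize_chain_is_linear A : linear (@realize_chain A).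
Proof.
move=> a x y; rewrite /realize_chain scaler_sumr -big_split /=.
by apply: eq_bigr => i _; rewrite !mxE scalerDl scalerA.
Qed.
HB.instance Definition _ A :=
  GRing.isLinear.Build F 'rV[F]_#|A| {ffun face -> F^o} *:%R (@realize_chain A)
    (@realize_chain_is_linear A).

Lemma realize_chainE A (x : 'rV[F]_#|A|) i : realize_chain x (enum_val i) = x 0 i.
Proof.
rewrite sum_ffunE (bigD1 i) //= big1 ?addr0 => [|j ji]; rewrite !ffunE.
  by rewrite eqxx [_ *: _]mulr1.
by rewrite (inj_eq enum_val_inj) eq_sym (negbTE ji) scaler0.
Qed.

Lemma realize_chain_notin A (x : 'rV[F]_#|A|) s : s \notin A -> realize_chain x s = 0.
Proof.
move=> sA; rewrite sum_ffunE big1 // => j _; rewrite !ffunE; case: eqP => [e|_].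
  by rewrite e enum_valP in sA.
by rewrite scaler0.
Qed.

Lemma realize_chain_inj A : injective (@realize_chain A).
Proof.
by move=> x y e; apply/rowP=> i; rewrite -!realize_chainE e.
Qed.

Lemma limg_realize_chain A : limg (linfun (@realize_chain A)) = chains F A.
Proof.
apply/vspaceP=> x; apply/memv_imgP/idP=> [[u _ ->]|/memv_chains x0].
  by rewrite lfunE; apply/memv_chains=> s; exact: realize_chain_notin.
exists (\row_i x (enum_val i)); rewrite ?memvf // lfunE /=; apply/ffunP=> s.
have [sA|sA] := boolP (s \in A); last by rewrite realize_chain_notin // x0.
by rewrite -(enum_rankK_in sA sA) realize_chainE mxE.
Qed.

Lemma bd_realize_chain K k (x : 'rV[F]_#|faces K k|) : down_closed K ->
  bd (realize_chain x) = realize_chain (x *m boundary F K k).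
Proof.
move=> dK; apply/ffunP=> t.
have -> : bd (realize_chain x) t = \sum_i x 0 i * incidence F (enum_val i) t.
  rewrite linear_sum sum_ffunE; apply: eq_bigr => i _.
  by rewrite linearZ ffunE incidence_bd.
have [tK|tK] := boolP (t \in faces K k.-1).
  rewrite -(enum_rankK_in tK tK) realize_chainE mxE.
  by apply: eq_bigr => i _; rewrite mxE.
rewrite realize_chain_notin // big1 // => i _.
rewrite /incidence big_pred0 ?mulr0 // => v; apply: contraNF tK => /andP[vs /eqP ->].
move: (enum_val i) vs (enum_valP i) => s vs; rewrite !inE => /andP[sK /eqP <-].
by rewrite (dK _ _ (subD1set _ _) sK) (cardsD1 v s) vs /= eqxx.
Qed.

Lemma mulmx_boundary K k : down_closed K -> boundary F K k.+1 *m boundary F K k = 0.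
Proof.
move=> dK; apply/row_matrixP=> i; rewrite rowE row0 mulmxA.
apply: (@realize_chain_inj (faces K k.-1)).
by rewrite -bd_realize_chain // -(@bd_realize_chain K k.+1) // bd_sqr linear0.
Qed.

Lemma rank_boundary K k : down_closed K ->
  \rank (boundary F K k) = \dim (boundaries F (faces K k)).
Proof.
move=> dK; rewrite -dim_limg_mulmxr /boundaries -limg_realize_chain.
have inj : lker (linfun (@realize_chain (faces K k.-1))) == 0%VS.
  by apply/lker0P=> x y; rewrite !lfunE; exact: realize_chain_inj.
rewrite -limg_comp (_ : (_ \o _)%VF =
  (linfun (@realize_chain (faces K k.-1)) \o linfun (mulmxr (boundary F K k)))%VF).
  by rewrite limg_comp [RHS]limg_dim_eq // (eqP inj) capv0.
by apply/lfunP=> x; rewrite !comp_lfunE !lfunE /= bd_realize_chain.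
Qed.

Lemma reduced_bettiE K k : down_closed K ->
  (reduced_betti F K k + (\rank (boundary F K k) + \rank (boundary F K k.+1)) =
   #|faces K k|)%N.
Proof.
move=> dK; have := mxrank_cap_compl (kermx (boundary F K k)) (boundary F K k.+1).
rewrite (capmx_idPr _); last by apply/sub_kermxP/mulmx_boundary.
rewrite mxrank_ker => e; rewrite addnCA [X in (_ + X)%N]addnC [X in (_ + X)%N]e.
by rewrite subnKC // rank_leq_row.
Qed.

Lemma chainsU A B : chains F (A :|: B) = (chains F A + chains F B)%VS.
Proof.
apply/eqP; rewrite eqEsubv subv_add !chains_subset ?subsetUl ?subsetUr // !andbT.
apply/subvP=> x /memv_chains x0.
pose y : {ffun face -> F^o} := [ffun s => if s \in A then x s else 0].
rewrite -[x](subrK y) addrC memv_add //; apply/memv_chains=> s sA; rewrite !ffunE.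
  by rewrite (negbTE sA).
case: ifPn => sA'; first by rewrite subrr.
by rewrite subr0 x0 // inE negb_or sA' sA.
Qed.

Lemma boundaries_support A x t : x \in boundaries F A -> x t != 0 ->
  exists2 v, v \notin t & v |: t \in A.
Proof.
case/memv_imgP=> y /memv_chains y0 -> xt.
apply/exists_inP; apply: contraR xt => /exists_inPn nA; rewrite bdE big1 // => v vt.
by rewrite y0 ?mulr0 // nA.
Qed.

(** Boundaries of faces of different sizes have disjoint supports, so the ungraded boundaries are
    the direct sum of the graded ones; the proof adds one size at a time. *)
Lemma dim_boundaries_faces K :
  \dim (boundaries F K) = (\sum_(k < m.+1) \dim (boundaries F (faces K k)))%N.
Proof.
pose sk n : {set face} := [set s in K | (#|s| < n)%N].
suff skE n : \dim (boundaries F (sk n)) = (\sum_(k < n) \dim (boundaries F (faces K k)))%N.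
  rewrite -skE; congr (\dim (boundaries F _)); apply/setP=> s.
  by rewrite inE ltnS (leq_trans (max_card _)) ?card_ord // andbT.
elim: n => [|n IH].
  rewrite big_ord0; apply/eqP; rewrite dimv_eq0 -subv0; apply/subvP=> x xB.
  rewrite memv0; apply/eqP/ffunP=> t; rewrite [RHS]ffunE; apply: contraTeq isT.
  by case/(boundaries_support xB) => v _; rewrite inE ltn0 andbF.
rewrite big_ord_recr /= -IH (_ : sk n.+1 = sk n :|: faces K n); last first.
  by apply/setP=> s; rewrite !inE ltnS leq_eqVlt orbC andb_orr.
rewrite /boundaries chainsU limgD dimv_disjoint_sum //; apply/eqP.
rewrite -subv0; apply/subvP=> x; rewrite memv_cap => /andP[xsk xfaces].
rewrite memv0; apply/eqP/ffunP=> t; rewrite [RHS]ffunE; apply: contraTeq isT => xt.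
have [u ut] := boundaries_support xsk xt; have [v vt] := boundaries_support xfaces xt.
by rewrite !inE !cardsU1 ut vt => /andP[_ /eqP ->]; rewrite ltnn andbF.
Qed.

(** Each degree loses the ranks of the boundaries out of it and into it. The ranks at [0] and [m.+1]
    vanish, so both sums of ranks agree; hence the factor 2 in [betti]. *)
Lemma sum_reduced_betti K : down_closed K ->
  (\sum_(k < m.+1) reduced_betti F K k)%N = betti F K.
Proof.
move=> dK; have rank0 : \rank (boundary F K 0) = 0%N.
  apply/eqP; rewrite mxrank_eq0; apply/eqP/matrixP=> i j; rewrite !mxE.
  have := enum_valP i; rewrite inE cards_eq0 => /andP[_ /eqP ->].
  by rewrite /incidence big_pred0 // => v; rewrite in_set0.
have rankm : \rank (boundary F K m.+1) = 0%N.
  apply/eqP; rewrite -leqn0; apply: leq_trans (rank_leq_row _) _.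
  rewrite leqn0 cards_eq0; apply/eqP/setP=> s; rewrite !inE.
  have := max_card (mem s); rewrite card_ord.
  by case: eqP => [->|]; rewrite ?ltnn ?andbF.
have cardK : (\sum_(k < m.+1) #|faces K k|)%N = #|K|.
  rewrite -sum1_card (partition_big (fun s => inord #|s| : 'I_m.+1) predT) //=.
  apply: eq_bigr => k _; rewrite -sum1_card; apply: eq_bigl => s; rewrite inE.
  congr (_ && _); rewrite -val_eqE /= inordK // ltnS.
  by apply: leq_trans (max_card _) _; rewrite card_ord.
have := bettiE F dK; rewrite -cardK dim_boundaries_faces.
under [X in _ = X -> _]eq_bigr do rewrite -(reduced_bettiE _ dK).
rewrite !big_split /=.
under [X in (2 * X)%N]eq_bigr do rewrite -rank_boundary //.
have -> : (\sum_(k < m.+1) \rank (boundary F K k.+1) =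
    \sum_(k < m.+1) \rank (boundary F K k))%N.
  by rewrite big_ord_recr rankm big_ord_recl rank0 /= addn0.
by rewrite mul2n -addnn => /addIn.
Qed.

Lemma tor_dimE K : down_closed K -> tor_dim F K = total_betti F K.
Proof.
by move=> dK; apply: eq_bigr => J _; apply: sum_reduced_betti; exact: down_closed_full.
Qed.

End Hochster.
(** * Complexes with private vertices *)

Section PrivateVertices.
Variable m : nat.
Local Notation face := {set 'I_m}.
Implicit Types (K : {set face}) (s t U J C W : face) (u v w : 'I_m) (G : 'I_m -> face).

Definition private W G := forall w, w \in W -> G w :&: W = [set w].

Lemma private_mem W G w : private W G -> w \in W -> w \in G w.
Proof. by move=> pW wW; have := set11 w; rewrite -(pW w wW) inE => /andP[]. Qed.

Lemma private_eq W G u w : private W G -> w \in W -> u \in W -> u \in G w -> u = w.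
Proof. by move=> pW wW uW uG; apply/set1P; rewrite -(pW w wW) inE uG. Qed.

(** The complex on [U] cut out by the non-faces [G w]. A [G w] may be a singleton, in which case [w]
    is in no face; this happens after passing to links. *)
Definition avoiding W G U : {set face} :=
  [set t : face | (t \subset U) && [forall w in W, ~~ (G w \subset t)]].

Lemma down_closed_avoiding W G U : down_closed (avoiding W G U).
Proof.
move=> s t ts; rewrite !inE => /andP[sU /forall_inP sG].
rewrite (subset_trans ts sU); apply/forall_inP=> w wW.
by apply: contra (sG w wW) => /subset_trans; apply.
Qed.

(** Adding [w] cannot complete a [G x] for another [x] in [W], because such a [G x] does not contain
    [w]. *)
Lemma private_apex W G w s : private W G -> w \in W -> ~~ (G w \subset w |: s) ->
  [forall w' in W, ~~ (G w' \subset s)] -> [forall w' in W, ~~ (G w' \subset w |: s)].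
Proof.
move=> pW wW nw /forall_inP ns; apply/forall_inP=> x xW.
have [->//|xw] := eqVneq x w; apply: contra (ns x xW) => /subsetP sub.
apply/subsetP=> y yG; have := sub y yG; rewrite inE => /orP[/set1P yw|//].
by rewrite yw in yG; rewrite (private_eq pW xW wW yG) eqxx in xw.
Qed.

(** Induction on [U :\: W]. For [u] in [G w] outside [W], the deletion of [u] is a cone with apex
    [w], and the link of [u] has the same form with [u] removed from every [G x]. If [U] lies in
    [W], each [G w] is [[set w]] and only the empty face remains. *)
Lemma betti_avoiding (F : fieldType) W G U : private W G ->
  \bigcup_(w in W) G w = U -> (betti F (avoiding W G U) <= 1)%N.
Proof.
have [n] := ubnP #|U :\: W|; elim: n U G => // n IH U G ltUn pW UE.
have dK : down_closed (avoiding W G U) by exact: down_closed_avoiding.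
have [UW|/subsetPn[u uU uW]] := boolP (U \subset W).
  rewrite (_ : avoiding W G U = [set set0]) ?betti_irrelevant //.
  apply/setP=> t; rewrite !inE; apply/andP/eqP=> [[tU /forall_inP nt]|->].
    apply/eqP; apply: contraT => /set0Pn[w wt].
    have wW := subsetP UW _ (subsetP tU _ wt).
    have := nt w wW; rewrite -(setIidPl (_ : G w \subset W)) ?pW ?sub1set ?wt //.
    by apply: subset_trans UW; rewrite -UE; exact: bigcup_sup.
  rewrite sub0set; split=> //; apply/forall_inP=> w wW.
  by apply/negP => /subsetP/(_ w (private_mem pW wW)); rewrite inE.
have [w wW uG] : exists2 w, w \in W & u \in G w by apply/bigcupP; rewrite UE.
apply: leq_trans (betti_deletion_link F u dK) _.
have apex : is_apex w (deletion u (avoiding W G U)).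
  move=> s; rewrite !inE => /andP[/andP[sU ns] us].
  have uw : u != w by apply: contraNneq uW => ->.
  rewrite negb_or uw us subUset sub1set sU andbT /= andbT.
  rewrite -{1}UE (subsetP (bigcup_sup w wW)) ?(private_mem pW wW) //=.
  apply: private_apex => //; apply/negP => /subsetP/(_ u uG).
  by rewrite !inE (negbTE uw) (negbTE us).
rewrite (betti_cone F (down_closed_deletion (v := u) dK) apex) add0n.
pose G' x := G x :\ u.
rewrite (_ : link u (avoiding W G U) = avoiding W G' (U :\ u)).
  apply: IH.
  - by rewrite setDDl setUC -setDDl; move: ltUn; rewrite (cardsD1 u (U :\: W)) inE uU uW.
  - move=> x xW; rewrite setIDAC pW // (setDidPl _) // disjoints1 inE.
    by apply: contraNneq uW => <-.
  - rewrite -UE; apply/setP=> x; rewrite 2!inE.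
    apply/bigcupP/andP=> [[y yW]|[xu /bigcupP[y yW xG]]].
      by rewrite 2!inE => /andP[xu xG]; split=> //; apply/bigcupP; exists y.
    by exists y; rewrite // 2!inE xu.
apply/setP=> t; rewrite !inE subsetD1 subUset sub1set uU andTb andbA [_ && (u \notin _)]andbC.
congr (_ && _); apply: eq_forallb_in => x xW; rewrite subDset //.
Qed.

(** Only the [G w] contained in [J] constrain [K|J]: a vertex of [J] outside their union can be
    added to any face, and if there is none, their private vertices are exactly [J :&: C]. *)
Lemma presents_full C G K J : presents C G K ->
  (exists2 v, v \in J & is_apex v (full_subcomplex K J)) \/
  J = \bigcup_(w in J :&: C) G w /\
  full_subcomplex K J = avoiding (J :&: C) G J.
Proof.
move=> [pC KE]; pose W := [set w in C | G w \subset J].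
have [sub|/subsetPn[v vJ vW]] := boolP (J \subset \bigcup_(w in W) G w); last first.
  left; exists v => // s; rewrite !inE !KE => /andP[/forall_inP ns sJ].
  rewrite subUset sub1set vJ sJ !andbT; apply/forall_inP=> w wC.
  have [vG|vG] := boolP (v \in G w).
    apply: contra vW => Gs; apply/bigcupP; exists w => //; rewrite inE wC.
    by apply: subset_trans Gs _; rewrite subUset sub1set vJ.
  by rewrite -subDset (setDidPl _) ?ns // disjoint_sym disjoints1.
have JE : J = \bigcup_(w in W) G w.
  by apply/eqP; rewrite eqEsubset sub; apply/bigcupsP=> w; rewrite inE => /andP[].
have WE : W = J :&: C.
  apply/setP=> w; rewrite 2!inE andbC; apply/andP/andP=> [[GJ wC]|[wJ wC]]; split=> //.
    exact: subsetP GJ _ (private_mem pC wC).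
  move: wJ; rewrite {1}JE => /bigcupP[x]; rewrite inE => /andP[xC xJ] wG.
  by rewrite (private_eq pC xC wC wG).
right; rewrite -WE; split=> //; apply/setP=> t; rewrite !inE KE andbC.
have [tJ|//] := boolP (t \subset J); apply/forall_inP/forall_inP=> nt w.
  by rewrite inE => /andP[/nt].
move=> wC; apply/negP => Gt; have := nt w; rewrite inE wC (subset_trans Gt tJ) Gt.
by move=> /(_ isT).
Qed.

Lemma private_sub C W G : private C G -> W \subset C -> private W G.
Proof.
move=> pC WC w wW; rewrite -(setIidPr WC) setIA pC ?(subsetP WC) //.
by apply/setIidPl; rewrite sub1set.
Qed.

(** In the fiber over [J] every complex is a cone except possibly the one for [t0], since [J :|: t]
    must be the union of the [G w] with [w] in [J]. *)
Lemma presents_tight_fibers (F : fieldType) s G K : down_closed K ->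
  presents (~: s) G K -> tight_fibers F s (~: s) K.
Proof.
move=> dK pres J Js; have [pC _] := pres.
pose t0 := s :&: \bigcup_(w in J) G w.
have JC t : t \subset s -> (J :|: t) :&: ~: s = J.
  move=> ts; rewrite setIUl (setIidPl Js) (_ : t :&: ~: s = set0) ?setU0 //.
  by apply/eqP; rewrite setI_eq0 -subsets_disjoint.
rewrite /fiber_betti (bigD1 t0) ?subsetIl //= big1 ?addn0 => [|t /andP[ts tt0]].
  have [[v _ /betti_cone ->//]|[/esym JE ->]] := presents_full (J :|: t0) pres.
    exact: down_closed_full.
  by apply: betti_avoiding; [exact: private_sub (subsetIr _ _)|].
have [[v _ /betti_cone ->//]|[JtE _]] := presents_full (J :|: t) pres.
  exact: down_closed_full.
case/eqP: tt0; rewrite JC // in JtE; rewrite /t0 -JtE setIUr.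
rewrite (_ : s :&: J = set0) ?set0U; first by apply/esym/setIidPr.
by apply/eqP; rewrite setIC setI_eq0 -[s]setCK -subsets_disjoint.
Qed.

(** The sum splits into [2 ^ #|~: s|] fibers, each at least 1, so it attains this value exactly when
    all of them are 1. *)
Lemma total_bettiE (F : fieldType) s K : down_closed K -> is_facet s (~: s) K ->
  total_betti F K = (2 ^ #|~: s|)%N <-> tight_fibers F s (~: s) K.
Proof.
move=> dK facet; rewrite /total_betti (sum_subset_pairs _ s).
have ge1 J : J \subset ~: s -> (1 <= fiber_betti F s K J)%N.
  by move=> Js; apply: fiber_betti_gt0 Js; rewrite // disjoint_sym -subsets_disjoint.
have := @leqif_sum _ (fun J => J \subset ~: s) (fun J => fiber_betti F s K J == 1%N)
  (fun=> 1%N) (fiber_betti F s K).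
have -> : (\sum_(J : face | J \subset ~: s) 1 = 2 ^ #|~: s|)%N.
  by rewrite -card_powerset -sum1_card; apply: eq_bigl => J; rewrite inE.
case=> [J Js|_ e].
  by split; [exact: ge1|rewrite eq_sym].
rewrite -/(fiber_betti F s K) in e *.
split=> [/esym/eqP|tight].
  by rewrite e => /forall_inP fib J /fib/eqP ->.
by apply/esym/eqP; rewrite e; apply/forall_inP=> J Js; rewrite eqn_leq tight ?ge1.
Qed.

Lemma mdim_facet K : down_closed K -> set0 \in K ->
  exists2 s, is_facet s (~: s) K & m%:Z - mdim K - 1 = #|~: s|%:Z.
Proof.
move=> dK K0; have [s0 s0max _] := @maxset_exists _ [pred t | t \in K] set0 K0.
have s0F : s0 \in facets K by rewrite inE.
have le s : s \in facets K -> face_dim s <= m%:Z - 1.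
  by move=> _; rewrite lerD2r lez_nat -[X in (_ <= X)%N]card_ord max_card.
rewrite /mdim (bigmin_eq_arg _ s0 _ _ s0F le); case: arg_minP => // s.
move=> sF _; have : s \in facets K by []; rewrite inE => /maxsetP[sK smax]; exists s.
  split=> // w; rewrite inE => ws; apply: contraNN ws => /smax/(_ (subsetUr _ _)) <-.
  exact: setU11.
by rewrite /face_dim; have := cardsC s; rewrite card_ord; lia.
Qed.

End PrivateVertices.

Lemma weakly_tautE (F : fieldType) m (K : {set {set 'I_m}}) s : down_closed K ->
  is_facet s (~: s) K -> m%:Z - mdim K - 1 = #|~: s|%:Z ->
  weakly_taut F K <-> tight_fibers F s (~: s) K.
Proof.
move=> dK facet dimE; rewrite -total_bettiE // /weakly_taut tor_dimE // dimE.
rewrite -exprnP -natrX; split=> [/eqP|->//]; rewrite eqr_nat => /eqP //.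
Qed.
From mathcomp Require Import all_classical all_reals all_analysis.
Import numFieldNormedType.Exports.
Local Open Scope classical_set_scope.

(** * Homotopy types *)

Section PointwiseContinuity.
Variables (R : realType) (T : topologicalType) (a : T).

Lemma continuous_for_comp (U V : topologicalType) (f : T -> U) (g : U -> V) :
  {for a, continuous f} -> {for f a, continuous g} ->
  {for a, continuous (fun x => g (f x))}.
Proof. exact: continuous_comp. Qed.

Lemma continuous_for_sub (V : normedModType R) (f g : T -> V) :
  {for a, continuous f} -> {for a, continuous g} ->
  {for a, continuous (fun x => f x - g x)}.
Proof. exact: continuousB. Qed.

Lemma continuous_for_add (V : normedModType R) (f g : T -> V) :
  {for a, continuous f} -> {for a, continuous g} ->
  {for a, continuous (fun x => f x + g x)}.
Proof. exact: continuousD. Qed.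

Lemma continuous_for_opp (f : T -> R) :
  {for a, continuous f} -> {for a, continuous (fun x => - f x)}.
Proof. by move=> fc; apply: cvgN. Qed.

Lemma continuous_for_mul (f g : T -> R) :
  {for a, continuous f} -> {for a, continuous g} ->
  {for a, continuous (fun x => f x * g x)}.
Proof. exact: continuousM. Qed.

Lemma continuous_for_sum I (r : seq I) (P : pred I) (f : I -> T -> R) :
  (forall i, P i -> {for a, continuous (f i)}) ->
  {for a, continuous (fun x => \sum_(i <- r | P i) f i x)}.
Proof. by apply: cvg_big => //; exact: add_continuous. Qed.

Lemma continuous_for_row n (f : 'I_n -> T -> R) :
  (forall j, {for a, continuous (f j)}) ->
  {for a, continuous (fun x => \row_j f j x)}.
Proof.
move=> fc B /= [P PB sPB]; rewrite /nbhs /=.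
suff: \forall x \near a, forall j, P ord0 j (f j x).
  apply: filterS => x Px; apply: sPB => i j.
  by rewrite mxE (ord1 i); exact: Px.
apply: filter_forall => j; apply: fc.
by have := PB ord0 j; rewrite mxE.
Qed.

Lemma continuous_for_pos (f : T -> R) : {for a, continuous f} ->
  {for a, continuous (fun x => Num.max (f x) 0)}.
Proof. by move=> fc; apply: continuous_max => //; exact: cvg_cst. Qed.

Lemma continuous_for_coord n (f : T -> 'rV[R]_n) i : {for a, continuous f} ->
  {for a, continuous (fun x => f x ord0 i)}.
Proof.
move=> fc; apply: (continuous_for_comp (g := fun M : 'rV[R]_n => M ord0 i)) => //.
exact: coord_continuous.
Qed.

End PointwiseContinuity.

(** The maps below are given by formulas on the ambient space and are continuous there at each point
    of the subset, which is stronger than continuity within it. *)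
Lemma continuous_for_within (T U : topologicalType) (A : set T) (f : T -> U) :
  (forall x, A x -> {for x, continuous f}) -> {within A, continuous f}.
Proof. by move=> fc; apply: continuous_in_subspaceT => x; rewrite inE; exact: fc. Qed.

Lemma continuous_for_cst (T U : topologicalType) (x : T) (u : U) :
  {for x, continuous (fun=> u)}.
Proof. exact: cvg_cst. Qed.

Lemma continuous_for_fst (T U : topologicalType) (x : T * U) :
  {for x, continuous (@fst T U)}.
Proof. exact: cvg_fst. Qed.

Lemma continuous_for_snd (T U : topologicalType) (x : T * U) :
  {for x, continuous (@snd T U)}.
Proof. exact: cvg_snd. Qed.

(** * Radial projections to total mass 1 and to the unit sphere *)

Section Normalisation.
Variables (R : realType) (n : nat).
Implicit Types (p r : 'rV[R]_n) (c : R).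

Definition mass p : R := \sum_i p ord0 i.
Definition euclid p : R := Num.sqrt (\sum_i p ord0 i ^+ 2).
Definition to_simplex p : 'rV[R]_n := (mass p)^-1 *: p.
Definition to_sphere p : 'rV[R]_n := (euclid p)^-1 *: p.

Lemma massZ c p : mass (c *: p) = c * mass p.
Proof. by rewrite /mass mulr_sumr; apply: eq_bigr => i _; rewrite mxE. Qed.

Lemma massD p r : mass (p + r) = mass p + mass r.
Proof. by rewrite /mass -big_split; apply: eq_bigr => i _; rewrite mxE. Qed.

Lemma sum_sqr_ge0 p : 0 <= \sum_i p ord0 i ^+ 2.
Proof. by apply: sumr_ge0 => i _; exact: sqr_ge0. Qed.

Lemma euclidZ c p : 0 <= c -> euclid (c *: p) = c * euclid p.
Proof.
move=> c0; rewrite /euclid -{2}(ger0_norm c0) -sqrtr_sqr -sqrtrM ?sqr_ge0 // mulr_sumr.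
by congr Num.sqrt; apply: eq_bigr => i _; rewrite mxE exprMn.
Qed.

Lemma euclid_gt0 p : p != 0 -> 0 < euclid p.
Proof.
move=> /rV0Pn[i pi]; rewrite sqrtr_gt0 (bigD1 i) //= ltr_wpDr ?exprn_even_gt0 //.
by apply: sumr_ge0 => j _; exact: sqr_ge0.
Qed.

Lemma to_simplexZ c p : c != 0 -> to_simplex (c *: p) = to_simplex p.
Proof. by move=> c0; rewrite /to_simplex massZ scalerA invfM mulrAC mulVf ?mul1r. Qed.

Lemma to_sphereZ c p : 0 < c -> to_sphere (c *: p) = to_sphere p.
Proof.
move=> c0; rewrite /to_sphere euclidZ ?ltW // scalerA invfM mulrAC mulVf ?mul1r //.
exact: lt0r_neq0.
Qed.

Lemma to_simplex_id p : mass p = 1 -> to_simplex p = p.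
Proof. by rewrite /to_simplex => ->; rewrite invr1 scale1r. Qed.

Lemma unit_sphereP p : unit_sphere R n p -> euclid p = 1.
Proof. by rewrite /unit_sphere /= /euclid => ->; rewrite sqrtr1. Qed.

Lemma to_sphere_id p : unit_sphere R n p -> to_sphere p = p.
Proof. by move/unit_sphereP; rewrite /to_sphere => ->; rewrite invr1 scale1r. Qed.

Lemma unit_sphere_neq0 p : unit_sphere R n p -> p != 0.
Proof.
move=> /unit_sphereP p1; apply: contra_eqN p1 => /eqP ->.
by rewrite -(scale0r 0) euclidZ // mul0r eq_sym oner_eq0.
Qed.

Lemma to_sphere_unit p : p != 0 -> unit_sphere R n (to_sphere p).
Proof.
move=> /euclid_gt0 p0; rewrite /unit_sphere /=.
under eq_bigr do rewrite mxE exprMn.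
rewrite -mulr_sumr exprVn -[X in _ * X]sqr_sqrtr ?sum_sqr_ge0 //.
by rewrite mulVf // expf_neq0 // lt0r_neq0.
Qed.

Lemma continuous_to_simplex p : mass p != 0 -> {for p, continuous to_simplex}.
Proof.
move=> p0; apply: continuousZ; last exact: cvg_id.
apply: continuousV => //; apply: continuous_for_sum => i _; exact: coord_continuous.
Qed.

Lemma continuous_to_sphere p : p != 0 -> {for p, continuous to_sphere}.
Proof.
move=> p0; apply: continuousZ; last exact: cvg_id.
apply: continuousV; first by rewrite lt0r_neq0 ?euclid_gt0.
apply: (continuous_for_comp (g := Num.sqrt)); last exact: sqrt_continuous.
apply: continuous_for_sum => i _.
have ci : {for p, continuous (fun x : 'rV[R]_n => x ord0 i)} by exact: coord_continuous.
exact: (continuousM ci ci).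
Qed.

End Normalisation.

(** * Contractibility of cones *)

Section Cones.
Variables (R : realType) (m : nat).
Local Notation vector := 'rV[R]_m.
Implicit Types (K : {set {set 'I_m}}) (p q : vector) (v : 'I_m).

Definition carrier p : {set 'I_m} := [set i | p ord0 i != 0]%SET.

Lemma realizationP K p :
  realization R K p <-> [/\ forall i, 0 <= p ord0 i, mass p = 1 & carrier p \in K].
Proof. by []. Qed.

Lemma to_simplex_realization K q : (forall i, 0 <= q ord0 i) -> 0 < mass q ->
  carrier q \in K -> realization R K (to_simplex q).
Proof.
move=> q0 massq qK; apply/realizationP; split=> [i||].
- by rewrite mxE mulr_ge0 // invr_ge0 ltW.
- by rewrite massZ mulVf // lt0r_neq0.
rewrite (_ : carrier _ = carrier q) //; apply/setP=> i; rewrite !inE mxE.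
by rewrite mulf_eq0 invr_eq0 (gt_eqF massq).
Qed.

Lemma mass_gt0 q i : (forall j, 0 <= q ord0 j) -> 0 < q ord0 i -> 0 < mass q.
Proof.
move=> q0 qi; rewrite /mass (bigD1 i) //= ltr_wpDr //.
by apply: sumr_ge0 => j _.
Qed.

Lemma mass_gt0P q : (forall j, 0 <= q ord0 j) -> 0 < mass q -> exists i, 0 < q ord0 i.
Proof.
move=> q0 massq; apply/existsP; apply: contraTT massq => /existsPn none.
rewrite -leNgt; apply: sumr_le0 => i _.
by have := none i; rewrite -leNgt.
Qed.

Lemma cone_contractible K v : down_closed K -> finset.set0 \in K -> is_apex v K ->
  homotopy_equivalent R (realization R K) [set (0 : R)].
Proof.
move=> dK K0 apex; pose e : vector := delta_mx ord0 v.
have e_ge0 i : 0 <= e ord0 i by rewrite mxE; case: (_ && _).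
have mass_e : mass e = 1.
  rewrite /mass (bigD1 v) //= big1 => [|i iv]; first by rewrite mxE !eqxx addr0.
  by rewrite mxE (negbTE iv) andbF.
(* The segment from the apex to [p] stays in [K], its carriers being contained in
   [v |: carrier p]. *)
have segment p (t : R) : 0 <= t <= 1 -> realization R K p ->
    realization R K ((1 - t) *: e + t *: p).
  move=> /andP[t0 t1] /realizationP[p0 p1 pK].
  have mass1 : mass ((1 - t) *: e + t *: p) = 1.
    by rewrite massD !massZ mass_e p1 !mulr1 subrK.
  apply/realizationP; split=> // [i|].
    by rewrite !mxE addr_ge0 // mulr_ge0 ?subr_ge0 //; have := e_ge0 i; rewrite mxE.
  apply: dK (apex _ pK); apply/fintype.subsetP=> i; rewrite !inE !mxE.
  have [//|iv] := eqVneq i v; rewrite eqxx /= mulr0 add0r.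
  by apply: contra => /eqP ->; rewrite mulr0.
have ein : realization R K e.
  apply/realizationP; split=> //; apply: dK (apex _ K0).
  apply/fintype.subsetP=> i; rewrite !inE mxE.
  by have [//|iv] := eqVneq i v; rewrite eqxx /= eqxx.
exists (fun=> 0), (fun=> e); split.
- split; first by apply: continuous_for_within => x _; exact: continuous_for_cst.
  by move=> _ [x _ <-].
- split; first by apply: continuous_for_within => x _; exact: continuous_for_cst.
  by move=> _ [x _ <-].
- exists (fun x => (1 - x.2) *: e + x.2 *: x.1); split.
  + split.
      apply: continuous_for_within => x _.
      have c2 := continuous_for_snd (x := x); have c1 := continuous_for_fst (x := x).
      apply: continuous_for_add; apply: continuousZ => //; last exact: continuous_for_cst.
      by apply: continuous_for_sub => //; exact: continuous_for_cst.
    by move=> _ [[x t] [/= xK]] + <-; rewrite in_itv /= => t01; exact: segment.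
  + by move=> x _ /=; rewrite subr0 scale1r scale0r addr0.
  + by move=> x _ /=; rewrite subrr scale0r add0r scale1r.
- exists (fun=> 0); split.
  + split; first by apply: continuous_for_within => x _; exact: continuous_for_cst.
    by move=> _ [x _ <-].
  + by [].
  + by move=> x ->.
Qed.

End Cones.

(** * The sphere defined by private vertices *)

Section Spheres.
Variables (R : realType) (m : nat) (W : {set 'I_m}) (G : 'I_m -> {set 'I_m}).
Local Notation vector := 'rV[R]_m.
Hypothesis privW : private W G.
Let U : {set 'I_m} := (\bigcup_(w in W) G w)%SET.
Let K := avoiding W G U.
Local Notation others := (U :\: W)%SET.
Local Notation n := #|others|.
Local Notation pos x := (Num.max x 0).
Implicit Types (p q : vector) (r : 'rV[R]_n) (w u i : 'I_m) (k : 'I_n) (t c : R).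

(** The weight that [p] gives to the point to which the private vertices are collapsed. *)
Let top p : R := \sum_(w in W) p ord0 w.

(* flatten and lift induce inverse homotopy equivalences between K and the unit
   sphere: the vertices outside W go to the coordinate directions, and all the
   private ones to (-1, ..., -1). *)
Definition flatten p : 'rV[R]_n := \row_k (p ord0 (enum_val k) - top p).

Definition lift r : vector :=
  \row_i if i \in W then \sum_(k | enum_val k \in G i :\ i) pos (- r ord0 k)
         else \sum_(k | enum_val k == i) pos (r ord0 k).

(* Along this path from p to lift (flatten p), the coordinate of w in W turns
   positive only when that of another vertex of G w has reached 0, so that the
   path stays in K. *)
Definition slide p t : vector :=
  \row_i if i \in W
         then (1 - t) * p ord0 i + \sum_(u in G i :\ i) pos (t * top p - p ord0 u)
         else pos (p ord0 i - t * top p).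

Let mem_others w u : w \in W -> u \in G w -> u != w -> u \in others.
Proof.
move=> wW uG uw; rewrite inE; apply/andP; split; last first.
  by apply/bigcupP; exists w.
by apply: contra uw => uW; apply/eqP; exact: (private_eq privW wW uW uG).
Qed.

Let others_mem u : u \in others -> exists2 w, w \in W & u \in G w :\ w.
Proof.
rewrite inE => /andP[uW /bigcupP[w wW uG]]; exists w => //; rewrite !inE uG andbT.
by apply: contraNneq uW => ->.
Qed.

Let WU w : w \in W -> w \in U.
Proof. by move=> wW; apply/bigcupP; exists w => //; exact: private_mem wW. Qed.

Let pos_ge0 (x : R) : 0 <= pos x. Proof. by rewrite le_max lexx orbT. Qed.

Let sum_pos_gt0 (I : finType) (P : pred I) (f : I -> R) (j : I) :
  P j -> 0 < f j -> 0 < \sum_(l | P l) pos (f l).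
Proof.
move=> Pj fj; rewrite (bigD1 j) //= ltr_wpDr ?lt_max ?fj //.
by apply: sumr_ge0 => l _.
Qed.

Let sum_pos_eq0 (I : finType) (P : pred I) (f : I -> R) :
  (forall j, P j -> f j <= 0) -> \sum_(j | P j) pos (f j) = 0.
Proof. by move=> f0; apply: big1 => j /f0; exact: max_r. Qed.

Let carrier_avoiding q : (forall i, i \notin U -> q ord0 i = 0) ->
  (forall w, w \in W -> exists2 u, u \in G w & q ord0 u = 0) -> carrier q \in K.
Proof.
move=> qU qG; rewrite inE; apply/andP; split.
  by apply/fintype.subsetP=> i; rewrite inE; apply: contraNT => /qU ->.
apply/forall_inP=> w /qG[u uG qu]; apply/negP => /fintype.subsetP/(_ u uG).
by rewrite inE qu eqxx.
Qed.

Let in_simplex p : realization R K p ->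
  [/\ forall i, 0 <= p ord0 i, mass p = 1, forall i, i \notin U -> p ord0 i = 0 &
      forall w, w \in W -> exists2 u, u \in G w & p ord0 u = 0].
Proof.
move=> /realizationP[p0 p1]; rewrite inE => /andP[/fintype.subsetP pU /forall_inP pG].
split=> // [i iU|w /pG /fintype.subsetPn[u uG]].
  by apply/eqP; apply: contraNT iU => pi; apply: pU; rewrite inE.
by rewrite inE negbK => /eqP pu; exists u.
Qed.

Let top_ge0 p : (forall i, 0 <= p ord0 i) -> 0 <= top p.
Proof. by move=> p0; apply: sumr_ge0. Qed.

Let le_top p w : (forall i, 0 <= p ord0 i) -> w \in W -> p ord0 w <= top p.
Proof. by move=> p0 wW; rewrite /top (bigD1 w) //= lerDl sumr_ge0. Qed.

Let top_gt0 p : (forall i, 0 <= p ord0 i) -> 0 < top p ->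
  exists2 w, w \in W & 0 < p ord0 w.
Proof.
move=> p0 tp; apply/exists_inP; apply: contraTT tp => /exists_inPn none.
by rewrite -leNgt; apply: sumr_le0 => w /none; rewrite -leNgt.
Qed.

Let topZ c p : top (c *: p) = c * top p.
Proof. by rewrite /top mulr_sumr; apply: eq_bigr => w _; rewrite mxE. Qed.

Let posZ c (x : R) : 0 <= c -> pos (c * x) = c * pos x.
Proof. by move=> c0; rewrite maxr_pMr // mulr0. Qed.

Lemma flattenZ c p : flatten (c *: p) = c *: flatten p.
Proof. by apply/rowP=> k; rewrite !mxE topZ mulrBr. Qed.

Lemma liftZ c r : 0 <= c -> lift (c *: r) = c *: lift r.
Proof.
move=> c0; apply/rowP=> i; rewrite !mxE.
by case: ifP => _; rewrite mulr_sumr; apply: eq_bigr => k _; rewrite mxE -posZ // mulrN.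
Qed.

Lemma slide0 p : realization R K p -> slide p 0 = p.
Proof.
case/in_simplex=> p0 _ _ _; apply/rowP=> i; rewrite mxE mul0r !subr0 mul1r.
case: ifP => _; last by rewrite max_l.
by rewrite sum_pos_eq0 ?addr0 // => u _; rewrite sub0r oppr_le0.
Qed.

Lemma slide1 p : realization R K p -> slide p 1 = lift (flatten p).
Proof.
case/in_simplex=> p0 _ pU _; apply/rowP=> i; rewrite !mxE mul1r subrr mul0r add0r.
have [iW|iW] := boolP (i \in W).
  under [RHS]eq_bigr do rewrite mxE opprB.
  rewrite -(@big_enum_val_cond _ _ _ _ (mem others) (fun u => u \in G i :\ i)
    (fun u => pos (top p - p ord0 u))) /=.
  apply: eq_bigl => u; rewrite andb_idl // !inE => /andP[ui uG].
  by have := mem_others iW uG ui; rewrite inE.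
under [RHS]eq_bigr do rewrite mxE.
rewrite -(@big_enum_val_cond _ _ _ _ (mem others) (fun u => u == i)
  (fun u => pos (p ord0 u - top p))) /=.
have [iU|iU] := boolP (i \in U).
  rewrite (big_pred1 i) // => u; rewrite andb_idl // => /eqP ->.
  by rewrite inE iW.
rewrite big_pred0 ?pU // ?sub0r => [|u]; last first.
  by case: eqP => [->|]; rewrite ?andbF // inE (negbTE iU) andbF.
by rewrite max_r // oppr_le0 top_ge0.
Qed.

Lemma slide_in p t : 0 <= t <= 1 -> realization R K p ->
  0 < mass (slide p t) /\ realization R K (to_simplex (slide p t)).
Proof.
move=> /andP[t0 t1] /in_simplex[p0 p1 pU pG]; have tp0 := top_ge0 p0.
have ttp0 : 0 <= t * top p by rewrite mulr_ge0.
have q0 i : 0 <= slide p t ord0 i.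
  rewrite mxE; case: ifP => // _; rewrite addr_ge0 ?sumr_ge0 //.
  by rewrite mulr_ge0 // subr_ge0.
have massq : 0 < mass (slide p t).
  (* If a private [w] has positive weight, a vertex of [G w] of weight 0 differs from [w] and
     contributes [t * top p], so the coordinate of [w] does not drop below [p ord0 w]. If there is
     no such [w], the coordinates outside [W] do not move. *)
  have [/(top_gt0 p0)[w wW pw]|] := ltP 0 (top p).
    apply: (mass_gt0 (i := w)) => //; rewrite mxE wW.
    have [u uG pu] := pG w wW.
    have uw : u != w by apply: contraTneq pw => <-; rewrite pu ltxx.
    rewrite (bigD1 u) ?inE ?uw ?uG //= pu subr0 max_l //.
    rewrite addrA ltr_wpDr ?sumr_ge0 //; apply: lt_le_trans pw _.
    by have := le_top p0 wW; nra.
  move=> tp_le0; have tpE : top p = 0 by apply/le_anti; rewrite tp_le0.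
  have [i pi] : exists i, 0 < p ord0 i by apply: mass_gt0P; rewrite ?p1.
  have iW : i \notin W by apply: contraTN pi => /(le_top p0); rewrite tpE -leNgt.
  by apply: (mass_gt0 (i := i)); rewrite // mxE (negbTE iW) tpE mulr0 subr0 max_l // ltW.
split=> //; apply: to_simplex_realization => //; apply: carrier_avoiding => [i iU|w wW].
  have iW : i \notin W by apply: contra iU; exact: WU.
  by rewrite mxE (negbTE iW) pU // sub0r max_r // oppr_le0.
(* Either another vertex of [G w] has reached 0, or all of them are still positive; then the zero of
   [p] in [G w] is [w] itself, which has received nothing. *)
have [/existsP[u /and3P[uG uw pu]]|/existsPn none] :=
    boolP [exists u, [&& u \in G w, u != w & p ord0 u <= t * top p]].
  exists u => //; have := mem_others wW uG uw; rewrite inE => /andP[uW _].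
  by rewrite mxE (negbTE uW) max_r // subr_le0.
exists w; first exact: private_mem wW.
have large u : u \in G w -> u != w -> t * top p < p ord0 u.
  by move=> uG uw; have := none u; rewrite uG uw /= -ltNge.
have [u uG pu] := pG w wW; have [uw|uw] := eqVneq u w; last first.
  by have := large u uG uw; rewrite pu ltNge ttp0.
rewrite mxE wW -uw pu mulr0 add0r sum_pos_eq0 // => x; rewrite uw !inE => /andP[xw xG].
by rewrite subr_le0 ltW // large.
Qed.

(** If [flatten p] were 0, all vertices of [U] outside [W] would have weight [top p]. This is 0,
    since a private [w] of positive weight needs a vertex of weight 0 in [G w]; then [p] has no
    mass. *)
Lemma flatten_neq0 p : realization R K p -> flatten p != 0.
Proof.
case/in_simplex=> p0 p1 pU pG; apply/negP => /eqP/rowP fp.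
have eq_top u : u \in others -> p ord0 u = top p.
  by move=> uo; have := fp (enum_rank_in uo u); rewrite !mxE enum_rankK_in // => /subr0_eq.
have tpE : top p = 0.
  apply/le_anti; rewrite top_ge0 // andbT leNgt; apply/negP => tp.
  have [w wW pw] := top_gt0 p0 tp; have [u uG pu] := pG w wW.
  have uw : u != w by apply: contraTneq pw => <-; rewrite pu ltxx.
  by rewrite -(eq_top u) ?(mem_others wW) // pu ltxx in tp.
have [i] : exists i, 0 < p ord0 i by apply: mass_gt0P; rewrite ?p1.
apply/negP; rewrite -leNgt; have [iW|iW] := boolP (i \in W); first by rewrite -tpE le_top.
have [iU|/pU -> //] := boolP (i \in U).
by rewrite eq_top ?tpE // inE iW.
Qed.

Let lift_others r k : lift r ord0 (enum_val k) = pos (r ord0 k).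
Proof.
rewrite mxE; have := enum_valP k; rewrite inE => /andP[/negbTE -> _].
by rewrite (big_pred1 k) // => j; rewrite (inj_eq enum_val_inj).
Qed.

(** If [r] is positive at all vertices of [G w] other than [w], the coordinate of [w] is a sum of
    vanishing negative parts; so each [G w] contains a zero. *)
Lemma lift_in r : r != 0 ->
  0 < mass (lift r) /\ realization R K (to_simplex (lift r)).
Proof.
move=> r0; have q0 i : 0 <= lift r ord0 i by rewrite mxE; case: ifP => _; exact: sumr_ge0.
have massq : 0 < mass (lift r).
  case/rV0Pn: r0 => k; rewrite neq_lt => /orP[rk|rk]; last first.
    by apply: (mass_gt0 (i := enum_val k)) => //; rewrite lift_others lt_max rk.
  have [w wW kG] := others_mem (enum_valP k).
  apply: (mass_gt0 (i := w)) => //; rewrite mxE wW.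
  by apply: (@sum_pos_gt0 _ _ (fun k => - r ord0 k) k) => //; rewrite oppr_gt0.
split=> //; apply: to_simplex_realization => //; apply: carrier_avoiding => [i iU|w wW].
  have iW : i \notin W by apply: contra iU; exact: WU.
  rewrite mxE (negbTE iW) big_pred0 // => k; apply: contraNF iU => /eqP <-.
  by have := enum_valP k; rewrite inE => /andP[].
have [/existsP[k /andP[kG rk]]|/existsPn none] :=
    boolP [exists k, (enum_val k \in G w :\ w) && (r ord0 k <= 0)].
  exists (enum_val k); first by move: kG; rewrite !inE => /andP[].
  by rewrite lift_others max_r.
exists w; first exact: private_mem wW.
rewrite mxE wW (@sum_pos_eq0 _ _ (fun k => - r ord0 k)) // => k kG.
by have := none k; rewrite kG /= -ltNge oppr_le0 => /ltW.
Qed.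

(** Where [r] is negative, so is [flatten (lift r)], hence also the segment; and if [r] has no
    negative coordinate, [flatten (lift r)] is [r]. *)
Lemma flatten_lift_segment r t : 0 <= t <= 1 -> r != 0 ->
  (1 - t) *: r + t *: flatten (lift r) != 0.
Proof.
move=> /andP[t0 t1] r0; have q0 i : 0 <= lift r ord0 i.
  by rewrite mxE; case: ifP => _; exact: sumr_ge0.
have [/existsP[k rk]|/existsPn nonneg] := boolP [exists k, r ord0 k < 0].
  have [w wW kG] := others_mem (enum_valP k).
  have tp : 0 < top (lift r).
    apply: lt_le_trans (le_top q0 wW); rewrite mxE wW.
    by apply: (@sum_pos_gt0 _ _ (fun k => - r ord0 k) k) => //; rewrite oppr_gt0.
  apply/rV0Pn; exists k; rewrite 3!mxE mxE lift_others max_r ?ltW // sub0r.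
  rewrite lt_eqF //; nra.
rewrite (_ : flatten (lift r) = r); first by rewrite -scalerDl subrK scale1r.
have top0 : top (lift r) = 0.
  apply: big1 => w wW; rewrite mxE wW (@sum_pos_eq0 _ _ (fun k => - r ord0 k)) // => k _.
  by rewrite oppr_le0 leNgt nonneg.
apply/rowP=> k; rewrite mxE lift_others top0 subr0 max_l // leNgt; exact: nonneg.
Qed.

Let continuous_top (T : topologicalType) (a : T) (h : T -> vector) :
  {for a, continuous h} -> {for a, continuous (fun x => top (h x))}.
Proof. by move=> hc; apply: continuous_for_sum => w _; exact: continuous_for_coord. Qed.

Lemma continuous_flatten p : {for p, continuous flatten}.
Proof.
have c i : {for p, continuous (fun q : vector => q ord0 i)} by exact: coord_continuous.
apply: continuous_for_row => k; apply: continuous_for_sub; first exact: c.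
by apply: continuous_top; exact: cvg_id.
Qed.

Lemma continuous_lift r : {for r, continuous lift}.
Proof.
have c k : {for r, continuous (fun q : 'rV[R]_n => q ord0 k)} by exact: coord_continuous.
apply: continuous_for_row => i; case: (i \in W); apply: continuous_for_sum => k _;
  apply: continuous_for_pos; last exact: c.
by apply: continuous_for_opp; exact: c.
Qed.

Lemma continuous_slide (x : vector * R) :
  {for x, continuous (fun x : vector * R => slide x.1 (1 - x.2))}.
Proof.
have c1 i : {for x, continuous (fun x : vector * R => x.1 ord0 i)}.
  by apply: continuous_for_coord; exact: continuous_for_fst.
have c2 : {for x, continuous (fun x : vector * R => 1 - x.2)}.
  by apply: continuous_for_sub; [exact: continuous_for_cst|exact: continuous_for_snd].
have ctop : {for x, continuous (fun x : vector * R => (1 - x.2) * top x.1)}.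
  by apply: continuous_for_mul => //; apply: continuous_top; exact: continuous_for_fst.
apply: continuous_for_row => i; case: (i \in W); last first.
  by apply: continuous_for_pos; apply: continuous_for_sub => //; exact: c1.
apply: continuous_for_add.
  apply: continuous_for_mul; last exact: c1.
  by apply: continuous_for_sub => //; exact: continuous_for_cst.
apply: continuous_for_sum => u _; apply: continuous_for_pos.
by apply: continuous_for_sub => //; exact: c1.
Qed.

Let onem_itv t : `[0, 1] t -> 0 <= 1 - t <= 1.
Proof. by rewrite /= in_itv /= => /andP[t0 t1]; rewrite subr_ge0 t1 gerBl. Qed.

(** The case of [n = 0] is included: both spaces are then empty. *)
Lemma avoiding_sphere :
  homotopy_equivalent R (realization R K) (unit_sphere R n).
Proof.
pose f p := to_sphere (flatten p); pose g r := to_simplex (lift r).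
have fc p : realization R K p -> {for p, continuous f}.
  move=> pK; apply: continuous_for_comp (@continuous_flatten p) _.
  exact/continuous_to_sphere/flatten_neq0.
have gc r : r != 0 -> {for r, continuous g}.
  move=> r0; apply: continuous_for_comp (@continuous_lift r) _.
  by apply: continuous_to_simplex; case: (lift_in r0) => /lt0r_neq0.
(* [flatten] and [lift] commute with positive scaling, so the inner normalisation is absorbed by the
   outer one. *)
have gfE p : realization R K p -> g (f p) = to_simplex (slide p 1).
  move=> pK; have fp0 := flatten_neq0 pK; have ep := euclid_gt0 fp0.
  by rewrite /g /f liftZ ?invr_ge0 ?ltW // to_simplexZ ?slide1 // invr_eq0 lt0r_neq0.
have fgE r : r != 0 -> f (g r) = to_sphere (flatten (lift r)).
  by move=> /lift_in[ml _]; rewrite /f /g flattenZ to_sphereZ // invr_gt0.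
exists f, g; split.
- split; first exact: continuous_for_within.
  by move=> _ [p pK <-]; exact/to_sphere_unit/flatten_neq0.
- split; first by apply: continuous_for_within => r /unit_sphere_neq0/gc.
  by move=> _ [r /unit_sphere_neq0/lift_in[_ ?] <-].
(* Time is reversed because [slide] starts at the identity, where the homotopy has to end. *)
- exists (fun x : vector * R => to_simplex (slide x.1 (1 - x.2))); split.
  + split; last first.
      by move=> _ [[p t] [/= pK /onem_itv t01] <-]; case: (slide_in t01 pK).
    apply: continuous_for_within => -[p t] [/= pK /onem_itv t01].
    apply: (continuous_for_comp (@continuous_slide (p, t))).
    by apply: continuous_to_simplex; case: (slide_in t01 pK) => /lt0r_neq0.
  + by move=> p pK /=; rewrite subr0 gfE.
  + by move=> p pK /=; rewrite subrr slide0 // to_simplex_id //; case: pK.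
- exists (fun x : 'rV[R]_n * R =>
    to_sphere ((1 - (1 - x.2)) *: x.1 + (1 - x.2) *: flatten (lift x.1))).
  split.
  + split; last first.
      move=> _ [[r t] [/= /unit_sphere_neq0 r0 /onem_itv t01] <-].
      exact/to_sphere_unit/flatten_lift_segment.
    apply: continuous_for_within => -[r t] [/= /unit_sphere_neq0 r0 /onem_itv t01].
    apply: (continuous_for_comp (g := @to_sphere R n)); last first.
      exact/continuous_to_sphere/flatten_lift_segment.
    have c1 := @continuous_for_fst _ _ (r, t).
    have c2 : {for (r, t), continuous (fun x : 'rV[R]_n * R => 1 - x.2)}.
      by apply: continuous_for_sub; [exact: continuous_for_cst|exact: continuous_for_snd].
    apply: continuous_for_add; apply: continuousZ => //.
      by apply: continuous_for_sub => //; exact: continuous_for_cst.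
    apply: (continuous_for_comp (g := flatten)); last exact: continuous_flatten.
    by apply: (continuous_for_comp (g := lift)) => //; exact: continuous_lift.
  + by move=> r /unit_sphere_neq0 r0 /=; rewrite subr0 subrr scale0r add0r scale1r fgE.
  + move=> r rS /=; rewrite subrr subr0 scale0r addr0 scale1r.
    exact: to_sphere_id.
Qed.

End Spheres.
Theorem theorem1p10 (R : realType) (m : nat) (K : {set {set 'I_m}})
    (F : fieldType) (hK : simplicial_complex K) (hF : weakly_taut F K) :
  (forall J : {set 'I_m},
     homotopy_equivalent R (realization R (full_subcomplex K J)) [set (0 : R)]
     \/ exists n : nat,
          homotopy_equivalent R (realization R (full_subcomplex K J))
            (unit_sphere R n)) /\
  (forall F' : fieldType, weakly_taut F' K).
Proof.
have [K0 _ dK] := hK.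
have [s facet dimE] := mdim_facet dK K0.
(* [F] enters only here: [G] describes [K] without a field, and both conclusions follow from it. *)
have [G pres] := tight_fibers_presents dK facet ((weakly_tautE F dK facet dimE).1 hF).
split=> [J|F']; last first.
  exact/(weakly_tautE F' dK facet dimE)/(presents_tight_fibers F' dK pres).
have [[v _ apex]|[JE ->]] := presents_full J pres.
  left; apply: cone_contractible apex; first exact: down_closed_full.
  by rewrite inE K0 finset.sub0set.
have priv : private (J :&: ~: s)%SET G.
  by apply: private_sub (finset.subsetIr J _); case: pres.
have sphere := avoiding_sphere R priv; rewrite -JE in sphere.
by right; eexists; exact: sphere.
Qed.
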